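(* Let $J\in\mathcal{T}(V,g)$ and put $S=J+\phi$, $T=J-\phi$. Define the bundle map $$\sigma:\mathfrak{gl}(\mathbb{V})\to T\mathcal{T},\qquad \sigma(A)=[SAT-TA^{*}S,\phi],$$ and the following bracket on $\Gamma(\mathfrak{gl}(\mathbb{V}))$: $$[A,B]^{\sigma}= dB_{\sigma(A)}+ \tfrac{1}{2}AS\phi S\{B,J\} -\tfrac{1}{2}\{A,J\}T\phi TB -(A \leftrightarrow B),$$ where $-(A\leftrightarrow B)$ means subtracting all preceding terms with $A$ and $B$ interchanged. Then $(\mathfrak{gl}(\mathbb{V}),[\cdot,\cdot]^{\sigma},\sigma)$ is a skew algebroid on $\mathcal{T}(V,g)$.
   Context: $(V,g)$ is a $2n$-dimensional real vector space with a positive definite metric. $\mathcal{T}=\mathcal{T}(V,g)=\{K\in \mathrm{End}V : K^{2}=-1,\ g(K\cdot,K\cdot)=g(\cdot,\cdot)\}$, a submanifold of $\mathrm{End}V$, with $T_K\mathcal{T}=\{A\in\mathfrak{o}(V,g): AK+KA=0\}$. $\mathbb{V}=V\times\mathcal{T}$ is the trivial bundle and $\mathfrak{gl}(\mathbb{V})=\mathrm{End}V\times\mathcal{T}$; its sections are smooth maps $\mathcal{T}\to\mathrm{End}V$. $\phi$ is the section given by $\phi|_K=K$, and $J$ is regarded as a constant section. $A^{*}$ is the adjoint of $A$ with respect to $g$; $[A,B]=AB-BA$ and $\{A,B\}=AB+BA$. $dB_X$ is the derivative of the section $B$ in the direction $X$ (trivial connection). A skew algebroid $(E,[\cdot,\cdot],\psi)$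 on $\mathcal{T}$ is a vector bundle $E\to\mathcal{T}$ with a skew bracket on $\Gamma(E)$ and a bundle map $\psi:E\to T\mathcal{T}$ such that for all $A,B\in\Gamma(E)$ and $f\in C^\infty(\mathcal{T})$: (a) $\psi([A,B])=[\psi(A),\psi(B)]_{Lie}$; (b) $[A,fB]=f[A,B]+\psi(A)[f]\,B$. *)

(* Defs.v *)
From HB Require Import structures.
From mathcomp Require Import all_boot all_order all_algebra.
From mathcomp Require Import all_classical all_reals all_analysis.
Set Implicit Arguments.
Unset Strict Implicit.
Unset Printing Implicit Defensive.
Import Order.TTheory GRing.Theory Num.Theory numFieldNormedType.Exports.
Local Open Scope classical_set_scope.
Local Open Scope ring_scope.

Section Calculus.
Variable R : realType.

(* For finite-dimensional E this is the usual notion of a C^k map on O, when O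
   is open. *)
Fixpoint Ck (E F : normedModType R) (k : nat) (O : set E) (f : E -> F) : Prop :=
  match k with
  | 0 => forall x, O x -> {for x, continuous f}
  | k'.+1 => (forall x, O x -> differentiable f x) /\
             (forall v : E, Ck k' O ('D_v f))
  end.

(* A vectType carries no topology. Its canonical topology and smooth structure
   are transported from row vectors through coordinates in a basis; they do not
   depend on the basis. *)
Definition coords (U : vectType R) : U -> 'rV[R]_(\dim {:U}) :=
  passmx.rVof (vbasis {:U}).

Definition of_coords (U : vectType R) : 'rV[R]_(\dim {:U}) -> U :=
  passmx.vecof (vbasis {:U}).

Definition in_coords (U W : vectType R) (F : U -> W)
    (u : 'rV[R]_(\dim {:U})) : 'rV[R]_(\dim {:W}) :=
  coords (F (of_coords u)).

Definition vopen (U : vectType R) (O : set U) : Prop :=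
  open [set u | O (of_coords u)].

Definition smooth_on (U W : vectType R) (O : set U) (F : U -> W) : Prop :=
  forall k, Ck k [set u | O (of_coords u)] (in_coords F).

Definition dir_derive (U W : vectType R) (F : U -> W) (x v : U) : W :=
  of_coords ('D_(coords v) (in_coords F) (coords x)).

(* F is, near x, a smooth extension to U of the map f defined on M only. *)
Definition local_ext (U W : vectType R) (M : set U) (f : M -> W) (x : M)
    (F : U -> W) : Prop :=
  exists O : set U,
    [/\ vopen O, O (val x), smooth_on O F &
        forall y : M, O (val y) -> F (val y) = f y].

Definition smooth (U W : vectType R) (M : set U) (f : M -> W) : Prop :=
  forall x : M, exists F, local_ext f x F.

(* The derivative df_v of f at x, computed on any smooth local extension. When
   M is a submanifold, f is smooth and v is tangent to M at x, it does not
   depend on the extension; it is a junk value otherwise. *)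
Definition tderive (U W : vectType R) (M : set U) (f : M -> W) (x : M) (v : U)
    : W :=
  xget 0 [set D | exists2 F, local_ext f x F & D = dir_derive F (val x) v].

End Calculus.

Section Twistor.
Variables (R : realType) (V : vectType R) (g : {dot V for (@idfun R)}).

Definition twistor : set 'End(V) :=
  [set K | (K \o K)%VF = - \1%VF /\ forall x y, g (K x) (K y) = g x y].

Definition orthogonal_lie : set 'End(V) :=
  [set A | forall x y, g (A x) y = - g x (A y)].

(* \o, + and - share one precedence level, hence the parentheses. *)
Definition tangent (K : 'End(V)) : set 'End(V) :=
  [set A | orthogonal_lie A /\ ((A \o K) + (K \o A))%VF = 0].

(* Positive definiteness of g makes such an endomorphism exist and be unique. *)
Definition adjoint (A : 'End(V)) : 'End(V) :=
  xget 0 [set B : 'End(V) | forall x y, g (A x) y = g x (B y)].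

Definition vector_field (X : twistor -> 'End(V)) : Prop :=
  smooth X /\ forall K : twistor, tangent (val K) (X K).

(* X[f] *)
Definition lie_derive (X : twistor -> 'End(V)) (f : twistor -> R^o)
    : twistor -> R^o :=
  fun K => tderive f K (X K).

(* Z = [X, Y], the vector field acting on functions as the commutator of the
   derivations X and Y. *)
Definition is_lie_bracket (X Y Z : twistor -> 'End(V)) : Prop :=
  vector_field Z /\
  forall f : twistor -> R^o, smooth f -> forall K,
    lie_derive Z f K =
    lie_derive X (lie_derive Y f) K - lie_derive Y (lie_derive X f) K.

(* Skew algebroids on the trivial bundle W x T(V,g), whose sections are the
   smooth maps T(V,g) -> W. The bracket is a total function on maps; only its
   values on smooth maps are constrained. *)
Record skew_algebroid (W : vectType R)
    (br : (twistor -> W) -> (twistor -> W) -> (twistor -> W))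
    (psi : twistor -> W -> 'End(V)) : Prop := SkewAlgebroid {
  anchor_linear : forall K, linear (psi K);
  anchor_field : forall A : twistor -> W, smooth A ->
    vector_field (fun K => psi K (A K));
  bracket_smooth : forall A B : twistor -> W, smooth A -> smooth B ->
    smooth (br A B);
  bracket_linear : forall (a : R) (A B C : twistor -> W),
    smooth A -> smooth B -> smooth C -> forall K,
    br (fun L => a *: A L + B L) C K = a *: br A C K + br B C K;
  bracket_skew : forall A B : twistor -> W, smooth A -> smooth B -> forall K,
    br A B K = - br B A K;
  anchor_bracket : forall A B : twistor -> W, smooth A -> smooth B ->
    is_lie_bracket (fun K => psi K (A K)) (fun K => psi K (B K))
                   (fun K => psi K (br A B K));
  bracket_leibniz : forall (A B : twistor -> W) (f : twistor -> R^o),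
    smooth A -> smooth B -> smooth f -> forall K,
    br A (fun L => f L *: B L) K =
    f K *: br A B K + lie_derive (fun L => psi L (A L)) f K *: B K
}.

Definition comm (A B : 'End(V)) : 'End(V) := ((A \o B) - (B \o A))%VF.
Definition anticomm (A B : 'End(V)) : 'End(V) := ((A \o B) + (B \o A))%VF.

Definition phi (K : twistor) : 'End(V) := val K.

Section Sigma.
Variable J : 'End(V).

Definition Splus (K : twistor) : 'End(V) := J + phi K.
Definition Tminus (K : twistor) : 'End(V) := J - phi K.

Definition sigma (K : twistor) (A : 'End(V)) : 'End(V) :=
  let S := Splus K in let T := Tminus K in
  comm ((S \o A \o T) - (T \o adjoint A \o S))%VF (phi K).

Definition sigma_half (A B : twistor -> 'End(V)) (K : twistor) : 'End(V) :=
  let S := Splus K in let T := Tminus K in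
  tderive B K (sigma K (A K))
  + 2^-1 *: (A K \o S \o phi K \o S \o anticomm (B K) J)%VF
  - 2^-1 *: (anticomm (A K) J \o T \o phi K \o T \o B K)%VF.

Definition sigma_bracket (A B : twistor -> 'End(V)) (K : twistor) : 'End(V) :=
  sigma_half A B K - sigma_half B A K.

End Sigma.
End Twistor.

(* Main.v *)
Require Import Defs.
From HB Require Import structures.
From mathcomp Require Import all_boot all_order all_algebra.
From mathcomp Require Import all_classical all_reals all_analysis.
From mathcomp Require Import lra.
Set Implicit Arguments.
Unset Strict Implicit.
Unset Printing Implicit Defensive.
Import Order.TTheory GRing.Theory Num.Theory numFieldNormedType.Exports.
Local Open Scope classical_set_scope.
Local Open Scope ring_scope.

(**
The anchor sigma sees a section A only through the anticommutators with J of
A and of its adjoint A'. Indeed J and K = phi|_K are complex structures, so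
S = J + K and T = J - K intertwine them: K S = S J, S K = J S, K T = - T J and
T K = - J T. Pushing K through S and T turns the definition of the anchor into
  sigma(A) = - S a T - T p S,   a = A J + J A,   p = A' J + J A'
(lemma sigmaE). Let b and q be the same expressions for B, and put X = sigma(A)
and Y = sigma(B), seen as maps from the twistor space to End V. Their Lie
bracket is dY(X) - dX(Y), and along X one has dS = X and dT = - X. The terms
which differentiate a, b, p, q give sigma(dB_X - dA_Y). Among the others, those
that mix S b T with T p S are symmetric in A and B and cancel, and what is left
is S m T + T m' S with
  m = a (S + T) b - b (S + T) a,   m' = q (S + T) p - p (S + T) q
(bracket_formula). The algebraic terms of the bracket are exactly what is needed
to produce this: if N denotes their sum then N J + J N = - m, because
S K S = J S^2, T K T = - J T^2 and S^2 + T^2 = -4, while a, b, S^2 and T^2 all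
commute with J (bracket_correction). Taking adjoints yields N' J + J N' = - m',
hence sigma(A bracket B) = dY(X) - dX(Y) (sigma_bracketE).

Two facts of calculus support this computation. The derivative of a section is
defined through a local extension to End V, and it is independent of the
extension along every tangent vector v at K, since v is the velocity at t = 0 of
the curve (1 + t u) K (1 + t u)^-1 in the twistor space, where u = K v / 2
(tangent_velocity, dir_derive_ext). Consequently sums, products and directional
derivatives of smooth sections are smooth and obey the usual rules. Finally the
symmetry of second derivatives (derive_comm), applied to smooth extensions,
shows that the commutator of the derivations X and Y is the derivation along
dY(X) - dX(Y) (tderive_commutator). The Leibniz rule and the linearity of the
bracket are then read off from its expression.
*)

(** * Maps of class C^k between normed modules *)

Section CkCalculus.
Context {R : realType}.
Implicit Types E F G : normedModType R.

(** Differentiability is a local property: the difference of the two functions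
vanishes near x, so it is differentiable there with differential 0. *)
Lemma near_differentiable E F (f g : E -> F) x :
  (\forall y \near x, f y = g y) -> differentiable f x -> differentiable g x.
Proof.
move=> fg df; have -> : g = f + (g - f) by apply/funext => y /=; rewrite addrC subrK.
apply: differentiableD => //; apply/diff_locallyP.
have gf0 : (g - f) \o shift x = cst ((g - f) x) + cst 0 +o_ 0 id.
  have := fg; rewrite (near_shift 0) subr0 => {}fg.
  apply/eqaddoP => _/posnumP[e]; near=> y => /=.
  suff -> : ((g - f) \o shift x - (cst ((g - f) x) + cst 0)) y = 0.
    by rewrite normr0 mulr_ge0.
  rewrite [LHS](_ : _ = (g (y + x) - f (y + x)) - ((g x - f x) + 0)) //.
  rewrite -(near fg y) //.
  by have /= := nbhs_singleton fg; rewrite add0r => ->; rewrite !subrr addr0 subr0.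
have d0 : 'd (g - f) x = cst 0 :> (E -> F).
  have cst0_linear : linear (cst 0 : E -> F).
    by move=> a u v /=; rewrite scaler0 addr0.
  pose z0 : {linear E -> F} :=
    HB.pack (cst 0 : E -> F) (GRing.isLinear.Build _ _ _ _ _ cst0_linear).
  by apply: (@diff_unique _ _ _ _ z0) => //; exact: cst_continuous.
by rewrite d0; split=> //; exact: cst_continuous.
Unshelve. all: by end_near. Qed.

(** Only the values on O matter. Openness of O is essential, since the
derivatives at a point of O see a whole neighbourhood of it. *)
Lemma Ck_ext E F k (O : set E) (f g : E -> F) : open O ->
  (forall x, O x -> f x = g x) -> Ck k O f -> Ck k O g.
Proof.
move=> oO; have near_eq (f' g' : E -> F) x : (forall x, O x -> f' x = g' x) ->
    O x -> \forall y \near x, f' y = g' y.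
  by move=> fg Ox; apply: filterS (open_nbhs_nbhs (conj oO Ox)) => y /fg.
elim: k f g => [|k IH] f g fg /=.
  move=> fC x Ox; move/(_ x Ox): fC.
  rewrite /prop_for /continuous_at -(fg _ Ox) => fC.
  by apply: cvg_trans fC; apply: near_eq_cvg; apply: near_eq.
move=> [df Df]; split=> [x Ox|v].
  by apply: near_differentiable (df x Ox); apply: near_eq.
apply: IH (Df v) => x Ox; apply: near_eq_derive; exact: near_eq.
Qed.

Lemma Ck_sub E F k (O O' : set E) (f : E -> F) :
  O' `<=` O -> Ck k O f -> Ck k O' f.
Proof.
move=> sO; elim: k f => [|k IH] f /= => [fC x /sO /fC //|[df Df]].
by split=> [x /sO /df //|v]; apply: IH.
Qed.

Lemma Ck_differentiable E F k (O : set E) (f : E -> F) x :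
  Ck k.+1 O f -> O x -> differentiable f x.
Proof. by move=> [df _]; apply: df. Qed.

Lemma CkW E F k (O : set E) (f : E -> F) : Ck k.+1 O f -> Ck k O f.
Proof.
elim: k f => [|k IH] f [df Df] /=; first by move=> x /df/differentiable_continuous.
by split=> // v; apply: IH.
Qed.

Lemma Ck_cst E F k (O : set E) (a : F) : Ck k O (cst a).
Proof.
elim: k a => [|k IH] a /=; first by move=> x _; exact: cst_continuous.
split=> [x _|v]; first exact: differentiable_cst.
by rewrite (_ : 'D_v (cst a) = cst 0) //; apply/funext => x; exact: derive_cst.
Qed.

Lemma CkD E F k (O : set E) (f g : E -> F) : open O ->
  Ck k O f -> Ck k O g -> Ck k O (f \+ g).
Proof.
move=> oO; elim: k f g => [|k IH] f g /=.
  by move=> fC gC x Ox; apply: continuousD; [apply: fC|apply: gC].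
move=> [df Df] [dg Dg]; split=> [x Ox|v].
  by apply: differentiableD; [apply: df|apply: dg].
apply: Ck_ext (IH _ _ (Df v) (Dg v)) => // x Ox /=; rewrite deriveD //.
  exact/diff_derivable/df.
exact/diff_derivable/dg.
Qed.

Lemma is_diff_bilin E E1 E2 F (b : {bilinear E1 -> E2 -> F})
    (f : E -> E1) (g : E -> E2) x :
  continuous (fun p => b p.1 p.2) -> differentiable f x -> differentiable g x ->
  is_diff x (fun y => b (f y) (g y))
    (fun v => b (f x) ('d g x v) + b ('d f x v) (g x)).
Proof.
move=> bC df dg; have bd := @differentiable_bilin _ _ _ _ b (f x, g x) bC.
have -> : (fun y => b (f y) (g y)) = (fun p => b p.1 p.2) \o (fun y => (f y, g y)).
  by [].
apply: DiffDef.
  by apply: differentiable_comp => //; exact: differentiable_pair.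
rewrite diff_comp //; last exact: differentiable_pair.
by rewrite diff_bilin // diff_pair.
Qed.

Lemma derive_bilin E E1 E2 F (b : {bilinear E1 -> E2 -> F})
    (f : E -> E1) (g : E -> E2) x v :
  continuous (fun p => b p.1 p.2) -> differentiable f x -> differentiable g x ->
  'D_v (fun y => b (f y) (g y)) x = b (f x) ('D_v g x) + b ('D_v f x) (g x).
Proof.
move=> bC df dg; have [bd bdE] := is_diff_bilin bC df dg.
by rewrite deriveE // bdE !deriveE.
Qed.

(** By the product rule the directional derivative is again a sum of two such
expressions, each with one factor differentiated, so induction on k applies. *)
Lemma Ck_bilin E E1 E2 F (b : {bilinear E1 -> E2 -> F}) k (O : set E)
    (f : E -> E1) (g : E -> E2) :
  continuous (fun p => b p.1 p.2) -> open O -> Ck k O f -> Ck k O g ->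
  Ck k O (fun y => b (f y) (g y)).
Proof.
move=> bC oO; elim: k f g => [|k IH] f g.
  move=> fC gC x Ox.
  apply: (@continuous_comp _ _ _ (fun y => (f y, g y)) (fun p => b p.1 p.2)).
    by apply: cvg_pair; [apply: fC | apply: gC].
  exact: bC.
move=> Cf Cg; have df x Ox := Ck_differentiable Cf (x := x) Ox.
have dg x Ox := Ck_differentiable Cg (x := x) Ox.
split=> [x Ox|v]; first by have [] := is_diff_bilin bC (df x Ox) (dg x Ox).
apply: Ck_ext (CkD oO (IH _ _ (CkW Cf) (Cg.2 v)) (IH _ _ (Cf.2 v) (CkW Cg))) => //.
by move=> x Ox; rewrite derive_bilin //; [apply: df|apply: dg].
Qed.

Lemma derive_lin E F G (L : {linear F -> G}) (f : E -> F) x v :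
  continuous L -> differentiable f x -> 'D_v (L \o f) x = L ('D_v f x).
Proof.
move=> LC df; have dL := @linear_differentiable _ _ _ L (f x) LC.
rewrite deriveE; last exact: differentiable_comp.
by rewrite (diff_comp df dL) (diff_lin _ LC) /= deriveE.
Qed.

Lemma Ck_lin E F G (L : {linear F -> G}) k (O : set E) (f : E -> F) :
  continuous L -> open O -> Ck k O f -> Ck k O (L \o f).
Proof.
move=> LC oO; elim: k f => [|k IH] f.
  by move=> fC x Ox; apply: continuous_comp; [apply: fC|apply: LC].
move=> [df Df]; split=> [x Ox|v].
  by apply: differentiable_comp; [apply: df|apply: linear_differentiable].
by apply: Ck_ext (IH _ (Df v)) => // x Ox; rewrite derive_lin //; apply: df.
Qed.

Lemma Ck_id E k (O : set E) : open O -> Ck k O id.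
Proof.
move=> oO; case: k => [|k]; first by move=> x _.
split=> [x _|v]; first exact: (@ex_diff _ _ _ _ _ id id).
by apply: Ck_ext (Ck_cst k O v) => // x _; rewrite derive_id.
Qed.

Lemma Ck_sum E F k (O : set E) n (f : 'I_n -> E -> F) : open O ->
  (forall i, Ck k O (f i)) -> Ck k O (fun x => \sum_i f i x).
Proof.
move=> oO fC; elim: n f fC => [|n IH] f fC.
  by apply: Ck_ext (Ck_cst k O 0) => // x _; rewrite big_ord0.
apply: Ck_ext (CkD oO (IH _ (fun i => fC (widen_ord (leqnSn n) i))) (fC ord_max)).
  by [].
by move=> x _; rewrite big_ord_recr.
Qed.

End CkCalculus.

(** * Symmetry of second derivatives *)

Section Curves.
Context {R : realType}.
Implicit Types E F : normedModType R.

Lemma is_derive_curve E F (f : E -> F) (c : R -> E) (s : R) u :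
  is_derive s (1 : R) c u -> differentiable f (c s) ->
  is_derive s (1 : R) (f \o c) ('D_u f (c s)).
Proof.
move=> [dc <-] df; have dc' := (derivable1_diffP c s).1 dc.
have dfc := differentiable_comp dc' df.
apply: DeriveDef; first exact/derivable1_diffP.
by rewrite !deriveE // diff_comp.
Qed.

Lemma is_derive_line E (v x : E) (s : R) :
  is_derive s (1 : R) (fun r : R => r *: v + x) v.
Proof.
apply: is_derive_eq (_ : is_derive s (1 : R) (( *:%R^~ v : R -> E) \+ cst x) (v + 0)) _.
  apply: is_deriveD; apply: DeriveDef.
    exact/derivable1_diffP.
  by rewrite deriveE // diff_val scale1r.
by rewrite addr0.
Qed.

(** Two applications of the mean value theorem to the second difference of f on
the parallelogram spanned by t v and t w. The left-hand side is symmetric in v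
and w while the right-hand side is not, and this forces the mixed derivatives
to agree in the limit. *)
Lemma mixed_difference E (O : set E) (f : E -> R) (x v w : E) (t : R) : 0 < t ->
  Ck 2 O f ->
  (forall a b, 0 <= a <= t -> 0 <= b <= t -> O (b *: w + (a *: v + x))) ->
  exists a b, [/\ 0 <= a <= t, 0 <= b <= t &
    f (t *: w + (t *: v + x)) - f (t *: v + x) - (f (t *: w + x) - f x) =
    'D_w ('D_v f) (b *: w + (a *: v + x)) * t * t].
Proof.
move=> t0 f2 Oab.
have df y : O y -> differentiable f y by exact: f2.1.
have dDf y : O y -> differentiable ('D_v f) y by exact: (f2.2 v).1.
have tt : 0 <= t <= t by rewrite lexx ltW.
have z0 : 0 <= (0 : R) <= t by rewrite lexx ltW.
have O0 a : 0 <= a <= t -> O (a *: v + x).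
  by move=> /(Oab _ 0)/(_ z0); rewrite scale0r add0r.
pose h (s : R) := f (s *: v + (t *: w + x)) - f (s *: v + x).
have dh (s : R) : 0 <= s <= t -> is_derive s (1 : R) h
    ('D_v f (s *: v + (t *: w + x)) - 'D_v f (s *: v + x)).
  move=> st; apply: is_deriveB.
    apply: (is_derive_curve (c := fun r => r *: v + _) (is_derive_line _ _ _)).
    by apply: df; rewrite addrCA; apply: Oab.
  apply: (is_derive_curve (c := fun r => r *: v + _) (is_derive_line _ _ _)).
  by apply: df; apply: O0.
have in_oo (s : R) : s \in `]0, t[ -> 0 <= s <= t.
  by rewrite in_itv /= => /andP[/ltW -> /ltW ->].
have in_cc (s : R) : s \in `[0, t] -> 0 <= s <= t by rewrite in_itv.
have cont (k dk : R -> R) :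
    (forall s : R, 0 <= s <= t -> is_derive s (1 : R) k (dk s)) ->
    {within `[0, t], continuous k}.
  move=> dk'; apply: derivable_within_continuous => s /in_cc /dk'.
  by move=> [].
have [a /in_oo a01 ha] := MVT t0 (fun s st => dh s (in_oo s st)) (cont _ _ dh).
pose k (r : R) := 'D_v f (r *: w + (a *: v + x)).
have dk (r : R) : 0 <= r <= t -> is_derive r 1 k ('D_w ('D_v f) (r *: w + (a *: v + x))).
  move=> rt; apply: (is_derive_curve (c := fun r => r *: w + _) (is_derive_line _ _ _)).
  by apply: dDf; apply: Oab.
have [b /in_oo b01 kb] := MVT t0 (fun s st => dk s (in_oo s st)) (cont _ _ dk).
exists a, b; split=> //.
move: ha; rewrite /h !scale0r !add0r subr0 addrCA => ->.
by move: kb; rewrite /k scale0r add0r subr0 addrCA => ->.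
Qed.

(** Schwarz's theorem. The two mixed derivatives take a common value at two
points of every small parallelogram at x, and both are continuous at x. *)
Theorem derive_comm E (O : set E) (f : E -> R) (x v w : E) : open O -> O x ->
  Ck 2 O f -> 'D_v ('D_w f) x = 'D_w ('D_v f) x.
Proof.
move=> oO Ox f2; apply/eqP; rewrite -subr_eq0 -normr_le0; apply/ler_addgt0Pl => e e0.
rewrite addr0.
have e20 : 0 < e / 2 by rewrite divr_gt0.
have close u u' :
    \forall y \near x, `|'D_u ('D_u' f) x - 'D_u ('D_u' f) y| < e / 2.
  have dD : differentiable ('D_u' f) x by exact: (f2.2 u').1.
  have cD : {for x, continuous ('D_u ('D_u' f))} by exact: ((f2.2 u').2 u).
  by move/cvgrPdist_lt: cD => /(_ _ e20).
have /nbhs_ballP[r /= r0 rP] : nbhs x (O `&` [set y |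
    `|'D_v ('D_w f) x - 'D_v ('D_w f) y| < e / 2 /\
    `|'D_w ('D_v f) x - 'D_w ('D_v f) y| < e / 2]).
  apply: filterI; first exact: open_nbhs_nbhs.
  by apply: filterI; exact: close.
(* The size t is chosen so that the parallelogram lies in the ball of radius r. *)
pose M := 1 + `|v| + `|w|.
have M0 : 0 < M by rewrite /M -addrA ltr_pwDl // addr_ge0.
pose t := r / (2 * M).
have t0 : 0 < t by rewrite divr_gt0 // mulr_gt0.
have inball a b : 0 <= a <= t -> 0 <= b <= t -> ball x r (b *: w + (a *: v + x)).
  move=> /andP[a0 at'] /andP[b0 bt].
  rewrite -ball_normE /= addrA opprD addrCA subrr addr0.
  rewrite normrN (le_lt_trans (ler_normD _ _)) // !normrZ !ger0_norm //.
  apply: (@le_lt_trans _ _ (t * (`|w| + `|v|))).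
    by rewrite mulrDr lerD // ler_wpM2r.
  have -> : r = t * (2 * M) by rewrite divfK // gt_eqF // mulr_gt0.
  rewrite ltr_pM2l // /M.
  by move: (normr_ge0 v) (normr_ge0 w) => ? ?; lra.
have inball' a b : 0 <= a <= t -> 0 <= b <= t -> ball x r (b *: v + (a *: w + x)).
  by move=> at' bt; rewrite addrCA; apply: inball.
have [a [b [at' bt E1]]] := mixed_difference t0 f2
  (fun a b at' bt => (rP _ (inball a b at' bt)).1).
have [a' [b' [at'' bt' E2]]] := mixed_difference t0 f2
  (fun a b at' bt => (rP _ (inball' a b at' bt)).1).
have [_ [_ c1]] := rP _ (inball _ _ at' bt).
have [_ [c2 _]] := rP _ (inball' _ _ at'' bt').
move: E1 c1; set d1 : R := 'D_w _ (b *: w + _) => E1 c1.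
move: E2 c2; set d2 : R := 'D_v _ (b' *: v + _) => E2 c2.
clearbody d1 d2.
have E3 : d1 = d2.
  have tn0 : t != 0 by rewrite gt_eqF.
  suff : d1 * t * t = d2 * t * t by move=> /(mulIf tn0)/(mulIf tn0).
  rewrite -E1 -E2 [t *: v + (_ + x)]addrCA.
  by rewrite !opprB addrACA [RHS]addrACA; congr (_ + _); rewrite addrC.
rewrite E3 in c1; rewrite -(subrKA d2) (splitr e).
apply: le_trans (ler_normD _ _) _; apply: lerD; apply: ltW; first exact: c2.
rewrite distrC; exact: c1.
Qed.

End Curves.

(** * Functions of a row vector *)

Section RowVectors.
Context {R : realType}.
Implicit Types E F : normedModType R.

Lemma linear_rowE m F (L : {linear 'rV[R]_m -> F}) u :
  L u = \sum_i u 0 i *: L (delta_mx 0 i).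
Proof.
rewrite {1}(matrix_sum_delta u) big_ord1 linear_sum /=.
by apply: eq_bigr => i _; rewrite linearZ.
Qed.

Lemma linear_row_differentiable m F (L : {linear 'rV[R]_m -> F}) u :
  differentiable L u.
Proof.
rewrite (_ : (L : _ -> _) = \sum_i (fun u : 'rV_m => u 0 i *: L (delta_mx 0 i))).
  apply: differentiable_sum => i.
  by apply: differentiableZl; exact: differentiable_coord.
by apply/funext => w; rewrite fct_sumE; exact: linear_rowE.
Qed.

Lemma linear_row_continuous m F (L : {linear 'rV[R]_m -> F}) : continuous L.
Proof. by move=> u; exact/differentiable_continuous/linear_row_differentiable. Qed.

Lemma bilinear_row_continuous m E F (b : {bilinear 'rV[R]_m -> E -> F}) :
  (forall u, continuous (b u)) -> continuous (fun p => b p.1 p.2).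
Proof.
move=> bC.
have -> : (fun p : 'rV[R]_m * E => b p.1 p.2) =
    \sum_i (fun p : 'rV[R]_m * E => p.1 0 i *: b (delta_mx 0 i) p.2).
  apply/funext => -[u y] /=; rewrite fct_sumE {1}(matrix_sum_delta u) big_ord1.
  by rewrite linear_sumlz /=; apply: eq_bigr => i _; rewrite linearZl_LR.
move=> p; elim/big_ind: _ => [|f g fC gC|i _]; first exact: cst_continuous.
  exact: continuousD.
apply: (@continuousZ _ _ _ (fun p : 'rV[R]_m * E => p.1 0 i)
                           (fun p : 'rV[R]_m * E => b (delta_mx 0 i) p.2)).
  apply: (@continuous_comp _ _ _ (@fst 'rV[R]_m E) (fun u : 'rV_m => u 0 i)).
    exact: cvg_fst.
  exact: coord_continuous.
apply: (@continuous_comp _ _ _ (@snd 'rV[R]_m E) (b (delta_mx 0 i))).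
  exact: cvg_snd.
exact: bC.
Qed.

Fact scale_bilinear F :
  bilinear_for
    (GRing.Scale.Law.clone _ _ *:%R _) (GRing.Scale.Law.clone _ _ *:%R _)
    (fun (a : R) (y : F) => a *: y).
Proof.
by split=> [u'|u] a x y /=; rewrite (scalerDl, scalerDr) -?scalerA // !scalerA mulrC.
Qed.

Definition scaleb F : {bilinear R -> F -> F} :=
  HB.pack (fun (a : R) (y : F) => a *: y)
    (bilinear_isBilinear.Build R R F F _ _
       (fun (a : R) (y : F) => a *: y) (scale_bilinear F)).

Lemma scaleb_continuous F : continuous (fun p => scaleb F p.1 p.2).
Proof. by move=> p; exact: scale_continuous. Qed.

Lemma CkZ E F k (O : set E) (a : E -> R) (f : E -> F) : open O ->
  Ck k O a -> Ck k O f -> Ck k O (fun x => a x *: f x).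
Proof. exact: (@Ck_bilin _ _ _ _ _ (scaleb F) _ _ _ _ (@scaleb_continuous F)). Qed.

Lemma derive_scale E F (a : E -> R) (f : E -> F) x v :
  differentiable a x -> differentiable f x ->
  'D_v (fun x => a x *: f x) x = a x *: 'D_v f x + 'D_v a x *: f x.
Proof. exact: (@derive_bilin _ _ _ _ _ (scaleb F) _ _ _ _ (@scaleb_continuous F)). Qed.

Definition coordl m (i : 'I_m) (u : 'rV[R]_m) : R := u 0 i.

Fact coordl_linear m (i : 'I_m) : linear (coordl i).
Proof. by move=> a u v; rewrite /coordl !mxE. Qed.
HB.instance Definition _ m (i : 'I_m) :=
  GRing.isLinear.Build R 'rV[R]_m R _ (coordl i) (@coordl_linear m i).

(** This expansion lets the direction u vary with the point: the coordinates
of u become coefficients in front of derivatives in fixed directions. *)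
Lemma derive_rowE m F (f : 'rV[R]_m -> F) x u : differentiable f x ->
  'D_u f x = \sum_i u 0 i *: 'D_(delta_mx 0 i) f x.
Proof.
move=> df; rewrite deriveE // linear_rowE.
by apply: eq_bigr => i _; rewrite deriveE.
Qed.

Lemma Ck_derive_field m F k (O : set 'rV[R]_m) (f : 'rV[R]_m -> F)
    (X : 'rV[R]_m -> 'rV[R]_m) : open O ->
  Ck k.+1 O f -> Ck k O X -> Ck k O (fun x => 'D_(X x) f x).
Proof.
move=> oO fk Xk.
apply: (Ck_ext oO (f := fun x => \sum_i X x 0 i *: 'D_(delta_mx 0 i) f x)).
  by move=> x Ox; rewrite -derive_rowE //; apply: fk.1.
apply: Ck_sum => // i; apply: CkZ => //; last exact: fk.2.
exact: (Ck_lin (L := coordl i) (@linear_row_continuous _ _ _) oO Xk).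
Qed.

(** Product rule for the derivative of f along the field X: the first term
freezes the direction at X x, the second one differentiates the direction. *)
Lemma derive_derive_field m F (O : set 'rV[R]_m) (f : 'rV[R]_m -> F)
    (X : 'rV[R]_m -> 'rV[R]_m) x v : open O -> O x -> Ck 2 O f ->
  differentiable X x ->
  'D_v (fun y => 'D_(X y) f y) x = 'D_v ('D_(X x) f) x + 'D_('D_v X x) f x.
Proof.
move=> oO Ox f2 dX.
have df y : O y -> differentiable f y by exact: f2.1.
have dDf i : differentiable ('D_(delta_mx 0 i) f) x by exact: (f2.2 _).1.
have nO : \forall y \near x, O y by exact: open_nbhs_nbhs.
have dXi i : differentiable (fun y => X y 0 i) x.
  exact: (differentiable_comp dX (linear_row_differentiable (coordl i) _)).
(* The formula is applied to X itself and to the constant field X x, whose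
   coordinates have derivative 0. *)
have dsum (Y : 'rV[R]_m -> 'rV[R]_m) : (forall i, differentiable (fun y => Y y 0 i) x) ->
   'D_v (fun y => 'D_(Y y) f y) x =
   \sum_i (Y x 0 i *: 'D_v ('D_(delta_mx 0 i) f) x +
           'D_v (fun y => Y y 0 i) x *: 'D_(delta_mx 0 i) f x).
  move=> dY; pose h i y := Y y 0 i *: 'D_(delta_mx 0 i) f y.
  have -> : 'D_v (fun y => 'D_(Y y) f y) x = 'D_v (\sum_i h i) x.
    apply: near_eq_derive; apply: filterS nO => y Oy.
    by rewrite derive_rowE ?fct_sumE //; apply: df.
  rewrite derive_sum => [|i]; first by apply: eq_bigr => i _; exact: derive_scale.
  apply: diff_derivable.
  by have [] := is_diff_bilin (@scaleb_continuous F) (dY i) (dDf i).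
rewrite (dsum X dXi) (dsum (cst (X x))) => [|i]; last exact: differentiable_cst.
rewrite big_split /= big_split /= -addrA; congr (_ + _).
rewrite [in RHS]big1 ?add0r => [|i _]; last first.
  by rewrite (_ : 'D_v _ x = 0) ?scale0r //; exact: derive_cst.
rewrite derive_rowE; last exact: df.
apply: eq_bigr => i _; congr (_ *: _).
exact: (derive_lin (L := coordl i) _ (@linear_row_continuous _ _ _) dX).
Qed.

Lemma derive_comm_row E n (O : set E) (f : E -> 'rV[R]_n) (x v w : E) :
  open O -> O x -> Ck 2 O f -> 'D_v ('D_w f) x = 'D_w ('D_v f) x.
Proof.
move=> oO Ox f2; apply/rowP => i.
have nO : \forall y \near x, O y by exact: open_nbhs_nbhs.
have Li := @linear_row_continuous _ _ (coordl i).
have key u u' : ('D_u ('D_u' f) x) 0 i = 'D_u ('D_u' (coordl i \o f)) x.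
  have -> : 'D_u ('D_u' (coordl i \o f)) x = 'D_u (coordl i \o 'D_u' f) x.
    apply: near_eq_derive; apply: filterS nO => y Oy.
    by rewrite derive_lin //; apply: f2.1.
  by rewrite derive_lin //; apply: (f2.2 u').1.
transitivity ('D_v ('D_w (coordl i \o f)) x).
  exact: key.
transitivity ('D_w ('D_v (coordl i \o f)) x); last first.
  exact/esym/key.
have C2 : Ck 2 O (coordl i \o f) by exact: Ck_lin.
exact: (derive_comm v w oO Ox C2).
Qed.

End RowVectors.

(** * Smooth maps between finite-dimensional vector spaces *)

Section VectCalculus.
Context {R : realType}.
Implicit Types U W : vectType R.

HB.instance Definition _ U := GRing.isLinear.Build R U 'rV[R]_(\dim {:U}) _
  (@coords R U) (passmx.rVof_linear (vbasis {:U})).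
HB.instance Definition _ U := GRing.isLinear.Build R 'rV[R]_(\dim {:U}) U _
  (@of_coords R U) (passmx.vecof_linear (vbasis {:U})).

Lemma coordsK U : cancel (@coords R U) (@of_coords R U).
Proof. exact/passmx.rVofK/vbasisP. Qed.

Lemma of_coordsK U : cancel (@of_coords R U) (@coords R U).
Proof. exact/passmx.vecofK/vbasisP. Qed.

Lemma vopenI U (O O' : set U) : vopen O -> vopen O' -> vopen (O `&` O').
Proof. exact: openI. Qed.

Lemma smooth_on_sub U W (O O' : set U) (F : U -> W) :
  O' `<=` O -> smooth_on O F -> smooth_on O' F.
Proof. by move=> sO FC k; apply: Ck_sub (FC k) => u /sO. Qed.

Lemma smooth_on_differentiable U W (O : set U) (F : U -> W) x :
  smooth_on O F -> O x -> differentiable (in_coords F) (coords x).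
Proof. by move=> /(_ 1%N)[dF _] Ox; apply: dF; rewrite /= coordsK. Qed.

Lemma smooth_on_cst U W (O : set U) (a : W) : smooth_on O (cst a).
Proof. by move=> k; exact: (@Ck_cst _ _ _ k _ (coords a)). Qed.

Lemma smooth_on_id U (O : set U) : vopen O -> smooth_on O id.
Proof.
move=> oO k; apply: Ck_ext (Ck_id k oO) => // u _.
by rewrite /in_coords of_coordsK.
Qed.

Lemma in_coords_lin U W W' (L : {linear W -> W'}) (F : U -> W) :
  in_coords (L \o F) = (coords (U := W') \o L \o of_coords (U := W)) \o in_coords F.
Proof. by apply/funext => u; rewrite /in_coords /= coordsK. Qed.

Lemma smooth_on_lin U W W' (L : {linear W -> W'}) (O : set U) (F : U -> W) :
  vopen O -> smooth_on O F -> smooth_on O (L \o F).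
Proof.
move=> oO FC k; rewrite in_coords_lin; apply: Ck_lin => //.
exact: linear_row_continuous.
Qed.

Lemma dir_derive_lin U W W' (L : {linear W -> W'}) (O : set U) (F : U -> W) x v :
  smooth_on O F -> O x -> dir_derive (L \o F) x v = L (dir_derive F x v).
Proof.
move=> FC Ox; have dF := smooth_on_differentiable FC Ox.
rewrite /dir_derive in_coords_lin derive_lin //=; last exact: linear_row_continuous.
by rewrite coordsK.
Qed.

Section Bilinear.
Variables (W1 W2 W3 : vectType R) (b : {bilinear W1 -> W2 -> W3}).

(** The bilinear map b read in coordinates. *)
Definition coords2 (u : 'rV[R]_(\dim {:W1})) (v : 'rV[R]_(\dim {:W2})) :
    'rV[R]_(\dim {:W3}) :=
  coords (b (of_coords u) (of_coords v)).

Fact coords2_bilinear :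
  bilinear_for
    (GRing.Scale.Law.clone _ _ *:%R _) (GRing.Scale.Law.clone _ _ *:%R _) coords2.
Proof.
by split=> [w|w] a u v; rewrite /coords2 /= linearP (linearPl, linearPr) linearP.
Qed.
HB.instance Definition _ :=
  bilinear_isBilinear.Build R _ _ _ _ _ coords2 coords2_bilinear.

Lemma coords2_continuous : continuous (fun p => coords2 p.1 p.2).
Proof.
apply: (bilinear_row_continuous (b := coords2)) => u.
exact: linear_row_continuous.
Qed.

Lemma in_coords_bilin U (F : U -> W1) (G : U -> W2) :
  in_coords (fun x => b (F x) (G x)) = fun u => coords2 (in_coords F u) (in_coords G u).
Proof. by apply/funext => u; rewrite /in_coords /coords2 !coordsK. Qed.

Lemma smooth_on_bilin U (O : set U) (F : U -> W1) (G : U -> W2) : vopen O ->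
  smooth_on O F -> smooth_on O G -> smooth_on O (fun x => b (F x) (G x)).
Proof.
move=> oO FC GC k; rewrite in_coords_bilin.
exact: (Ck_bilin (b := coords2) coords2_continuous).
Qed.

Lemma dir_derive_bilin U (O : set U) (F : U -> W1) (G : U -> W2) x v :
  smooth_on O F -> smooth_on O G -> O x ->
  dir_derive (fun y => b (F y) (G y)) x v =
  b (F x) (dir_derive G x v) + b (dir_derive F x v) (G x).
Proof.
move=> FC GC Ox; rewrite /dir_derive in_coords_bilin.
rewrite (derive_bilin (b := coords2) _ coords2_continuous); first last.
- exact: smooth_on_differentiable GC Ox.
- exact: smooth_on_differentiable FC Ox.
by rewrite linearD /coords2 /in_coords /= !coordsK.
Qed.

End Bilinear.

Lemma smooth_onD U W (O : set U) (F G : U -> W) : vopen O ->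
  smooth_on O F -> smooth_on O G -> smooth_on O (fun x => F x + G x).
Proof.
move=> oO FC GC k; apply: Ck_ext (CkD oO (FC k) (GC k)) => // u _.
by rewrite /in_coords linearD.
Qed.

Lemma dir_deriveD U W (O : set U) (F G : U -> W) x v :
  smooth_on O F -> smooth_on O G -> O x ->
  dir_derive (fun y => F y + G y) x v = dir_derive F x v + dir_derive G x v.
Proof.
move=> FC GC Ox; rewrite /dir_derive.
have -> : in_coords (fun y => F y + G y) = in_coords F + in_coords G.
  by apply/funext => u; rewrite /in_coords linearD.
rewrite deriveD ?linearD //; apply: diff_derivable.
  exact: smooth_on_differentiable FC Ox.
exact: smooth_on_differentiable GC Ox.
Qed.

Lemma dir_derive_cst U W (a : W) (x v : U) : dir_derive (cst a) x v = 0.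
Proof.
rewrite /dir_derive (_ : in_coords (cst a : U -> W) = cst (coords a)) //.
by rewrite derive_cst linear0.
Qed.

Lemma dir_derive_id U (x v : U) : dir_derive id x v = v.
Proof.
rewrite /dir_derive (_ : in_coords id = id); first by rewrite derive_id coordsK.
by apply/funext => u; rewrite /in_coords of_coordsK.
Qed.

Lemma dir_derive_linear U W (O : set U) (F : U -> W) x : smooth_on O F -> O x ->
  linear (dir_derive F x).
Proof.
move=> FC Ox a v w; have dF := smooth_on_differentiable FC Ox.
by rewrite /dir_derive !deriveE // !linearP.
Qed.

Lemma in_coords_dir_derive U W (F : U -> W) (X : U -> U) :
  in_coords (fun x => dir_derive F x (X x)) =
  fun u => 'D_(in_coords X u) (in_coords F) u.
Proof.
by apply/funext => u; rewrite {1}/in_coords /dir_derive !of_coordsK.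
Qed.

Lemma smooth_on_dir_derive U W (O : set U) (F : U -> W) (X : U -> U) : vopen O ->
  smooth_on O F -> smooth_on O X -> smooth_on O (fun x => dir_derive F x (X x)).
Proof.
by move=> oO FC XC k; rewrite in_coords_dir_derive; apply: Ck_derive_field.
Qed.

(** Second derivatives split into a frozen part, which is symmetric by
dir_derive_comm, and the derivative of the direction field. *)
Lemma dir_derive_field U W (O : set U) (F : U -> W) (X : U -> U) x v : vopen O ->
  O x -> smooth_on O F -> smooth_on O X ->
  dir_derive (fun y => dir_derive F y (X y)) x v =
  dir_derive (fun y => dir_derive F y (X x)) x v +
  dir_derive F x (dir_derive X x v).
Proof.
move=> oO Ox FC XC; have dX := smooth_on_differentiable XC Ox.
have Ox' : [set u | O (of_coords u)] (coords x) by rewrite /= coordsK.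
have Xx : in_coords X (coords x) = coords (X x) by rewrite /in_coords coordsK.
have Dv : dir_derive (fun y => dir_derive F y (X x)) x v =
    of_coords ('D_(coords v) ('D_(coords (X x)) (in_coords F)) (coords x)).
  have <- : in_coords (fun y => dir_derive F y (X x)) =
      'D_(coords (X x)) (in_coords F).
    by apply/funext => u; rewrite /in_coords /dir_derive !of_coordsK.
  by [].
transitivity (of_coords ('D_(coords v)
    (fun u => 'D_(in_coords X u) (in_coords F) u) (coords x))).
  by rewrite -in_coords_dir_derive.
have H := derive_derive_field (coords v) oO Ox' (FC 2%N) dX.
have EX : coords (dir_derive X x v) = 'D_(coords v) (in_coords X) (coords x).
  exact: of_coordsK.
by rewrite H [LHS]linearD /= Xx -Dv -EX.
Qed.

Lemma dir_derive_comm U W (O : set U) (F : U -> W) x v w : vopen O -> O x ->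
  smooth_on O F ->
  dir_derive (fun y => dir_derive F y v) x w =
  dir_derive (fun y => dir_derive F y w) x v.
Proof.
move=> oO Ox FC.
have Ox' : [set u | O (of_coords u)] (coords x) by rewrite /= coordsK.
have E u : in_coords (fun y => dir_derive F y u) = 'D_(coords u) (in_coords F).
  by apply/funext => y; rewrite /in_coords /dir_derive !of_coordsK.
transitivity (of_coords ('D_(coords w) ('D_(coords v) (in_coords F)) (coords x))).
  by rewrite -(E v).
rewrite (derive_comm_row _ _ oO Ox' (FC 2%N)).
by rewrite -(E w).
Qed.

End VectCalculus.

(** * Derivatives of maps defined on a subset *)

Section Sections.
Context {R : realType} {U : vectType R}.
Implicit Types W : vectType R.

(** The vectors along which derivatives of maps defined on M alone make sense. *)
Definition velocity (M : set U) (x v : U) : Prop :=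
  exists c : R -> U, [/\ forall t, M (c t), c 0 = x &
    is_derive (0 : R) (1 : R) (@coords R U \o c) (coords v)].

Variable M : set U.
Implicit Types x : M.

(** Both extensions coincide with f along a curve in M with velocity v, and by
the chain rule the derivative along the curve determines the derivative in the
direction v. *)
Lemma dir_derive_ext W (f : M -> W) x F G v :
  local_ext f x F -> local_ext f x G -> velocity M (val x) v ->
  dir_derive F (val x) v = dir_derive G (val x) v.
Proof.
move=> [OF [oF OFx FC FE]] [OG [oG OGx GC GE]] [c [Mc c0 dc]].
have cE (H : U -> W) : in_coords H \o (@coords R U \o c) = coords (U := W) \o H \o c.
  by apply/funext => t; rewrite /in_coords /= coordsK.
have c0' : (@coords R U \o c) 0 = coords (val x) by rewrite /= c0.
have dF : is_derive (0 : R) (1 : R) (in_coords F \o (@coords R U \o c))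
    ('D_(coords v) (in_coords F) (coords (val x))).
  rewrite -c0'; apply: is_derive_curve dc _; rewrite c0'.
  exact: smooth_on_differentiable FC OFx.
have dG : is_derive (0 : R) (1 : R) (in_coords G \o (@coords R U \o c))
    ('D_(coords v) (in_coords G) (coords (val x))).
  rewrite -c0'; apply: is_derive_curve dc _; rewrite c0'.
  exact: smooth_on_differentiable GC OGx.
have cC : {for 0, continuous (@coords R U \o c)}.
  apply: differentiable_continuous; apply/derivable1_diffP.
  by case: dc.
have oFG := vopenI oF oG.
have near_c : \forall t \near (0 : R), (OF `&` OG) (c t).
  have nO : nbhs ((@coords R U \o c) 0) [set u | (OF `&` OG) (of_coords u)].
    by apply: open_nbhs_nbhs; split=> //; rewrite c0' /= coordsK.
  have cO : \forall t \near (0 : R), (OF `&` OG) (of_coords (coords (c t))).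
    exact: cC _ nO.
  by apply: filterS cO => t; rewrite coordsK.
rewrite /dir_derive; congr of_coords.
rewrite -(@derive_val _ _ _ _ _ _ _ dF) -(@derive_val _ _ _ _ _ _ _ dG) !cE.
apply: near_eq_derive; apply: filterS near_c => t [OFt OGt] /=.
pose y : M := exist _ (c t) (mem_set (Mc t)).
by rewrite -[c t]/(val y) FE ?GE.
Qed.

Lemma tderiveE W (f : M -> W) x F v : local_ext f x F -> velocity M (val x) v ->
  tderive f x v = dir_derive F (val x) v.
Proof.
move=> fF vv; rewrite /tderive.
have ex : exists D, [set D | exists2 G, local_ext f x G & D = dir_derive G (val x) v] D.
  by exists (dir_derive F (val x) v), F.
by have [G fG ->] := xgetPex 0 ex; exact: dir_derive_ext fG fF vv.
Qed.

Lemma smooth_cst W (a : W) : smooth (cst a : M -> W).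
Proof.
move=> x; exists (cst a), setT; split=> //; last exact: smooth_on_cst.
exact: openT.
Qed.

Lemma smooth_val : smooth (val : M -> U).
Proof.
move=> x; exists id, setT; split=> //; first exact: openT.
by apply: smooth_on_id; exact: openT.
Qed.

Lemma tderive_cst W (a : W) x v : velocity M (val x) v ->
  tderive (cst a : M -> W) x v = 0.
Proof.
have aE : local_ext (cst a : M -> W) x (cst a).
  exists setT; split=> //; first exact: openT.
  exact: smooth_on_cst.
by move=> vv; rewrite (tderiveE aE vv) dir_derive_cst.
Qed.

Lemma tderive_val x v : velocity M (val x) v -> tderive (val : M -> U) x v = v.
Proof.
have valE : local_ext (val : M -> U) x id.
  exists setT; split=> //; first exact: openT.
  by apply: smooth_on_id; exact: openT.
by move=> vv; rewrite (tderiveE valE vv) dir_derive_id.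
Qed.

Lemma local_ext_lin W W' (L : {linear W -> W'}) (f : M -> W) x F :
  local_ext f x F -> local_ext (fun y => L (f y)) x (fun u => L (F u)).
Proof.
move=> [N [oN Nx FC FE]]; exists N; split=> //; first exact: smooth_on_lin.
by move=> y Ny; rewrite FE.
Qed.

Lemma smooth_lin W W' (L : {linear W -> W'}) (f : M -> W) :
  smooth f -> smooth (fun y => L (f y)).
Proof.
move=> fC x; have [F fF] := fC x.
by exists (fun u => L (F u)); exact: local_ext_lin.
Qed.

Lemma tderive_lin W W' (L : {linear W -> W'}) (f : M -> W) x v : smooth f ->
  velocity M (val x) v -> tderive (fun y => L (f y)) x v = L (tderive f x v).
Proof.
move=> /(_ x)[F fF] vv; rewrite (tderiveE (local_ext_lin L fF) vv) (tderiveE fF vv).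
by case: fF => N [oN Nx FC FE]; exact: dir_derive_lin FC Nx.
Qed.

Lemma local_extD W (f g : M -> W) x F G : local_ext f x F -> local_ext g x G ->
  local_ext (fun y => f y + g y) x (fun u => F u + G u).
Proof.
move=> [OF [oF OFx FC FE]] [OG [oG OGx GC GE]].
have oFG := vopenI oF oG.
exists (OF `&` OG); split=> // [|y [OFy OGy]]; last by rewrite FE ?GE.
apply: smooth_onD => //; first by apply: smooth_on_sub FC => u [].
by apply: smooth_on_sub GC => u [].
Qed.

Lemma smoothD W (f g : M -> W) : smooth f -> smooth g -> smooth (fun y => f y + g y).
Proof.
move=> fC gC x; have [F fF] := fC x; have [G gG] := gC x.
by exists (fun u => F u + G u); exact: local_extD.
Qed.

Lemma tderiveD W (f g : M -> W) x v : smooth f -> smooth g ->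
  velocity M (val x) v ->
  tderive (fun y => f y + g y) x v = tderive f x v + tderive g x v.
Proof.
move=> /(_ x)[F fF] /(_ x)[G gG] vv.
rewrite (tderiveE (local_extD fF gG) vv) (tderiveE fF vv) (tderiveE gG vv).
case: fF gG => [OF [oF OFx FC FE]] [OG [oG OGx GC GE]].
apply: (@dir_deriveD _ _ _ (OF `&` OG)); last by split.
  by apply: smooth_on_sub FC => u [].
by apply: smooth_on_sub GC => u [].
Qed.

Lemma local_ext_bilin W1 W2 W3 (b : {bilinear W1 -> W2 -> W3})
    (f : M -> W1) (g : M -> W2) x F G : local_ext f x F -> local_ext g x G ->
  local_ext (fun y => b (f y) (g y)) x (fun u => b (F u) (G u)).
Proof.
move=> [OF [oF OFx FC FE]] [OG [oG OGx GC GE]].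
have oFG := vopenI oF oG.
exists (OF `&` OG); split=> // [|y [OFy OGy]]; last by rewrite FE ?GE.
apply: smooth_on_bilin => //; first by apply: smooth_on_sub FC => u [].
by apply: smooth_on_sub GC => u [].
Qed.

Lemma smooth_bilin W1 W2 W3 (b : {bilinear W1 -> W2 -> W3})
    (f : M -> W1) (g : M -> W2) :
  smooth f -> smooth g -> smooth (fun y => b (f y) (g y)).
Proof.
move=> fC gC x; have [F fF] := fC x; have [G gG] := gC x.
by exists (fun u => b (F u) (G u)); exact: local_ext_bilin.
Qed.

Lemma tderive_bilin W1 W2 W3 (b : {bilinear W1 -> W2 -> W3})
    (f : M -> W1) (g : M -> W2) x v : smooth f -> smooth g ->
  velocity M (val x) v ->
  tderive (fun y => b (f y) (g y)) x v =
  b (f x) (tderive g x v) + b (tderive f x v) (g x).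
Proof.
move=> /(_ x)[F fF] /(_ x)[G gG] vv.
rewrite (tderiveE (local_ext_bilin b fF gG) vv) (tderiveE fF vv) (tderiveE gG vv).
case: fF gG => [OF [oF OFx FC FE]] [OG [oG OGx GC GE]].
rewrite -FE // -GE //; apply: (@dir_derive_bilin _ _ _ _ b _ (OF `&` OG)); last by split.
  by apply: smooth_on_sub FC => u [].
by apply: smooth_on_sub GC => u [].
Qed.

Lemma tderive_linear W (f : M -> W) x a v w : smooth f ->
  velocity M (val x) v -> velocity M (val x) w -> velocity M (val x) (a *: v + w) ->
  tderive f x (a *: v + w) = a *: tderive f x v + tderive f x w.
Proof.
move=> /(_ x)[F fF] vv vw vvw; rewrite !(tderiveE fF) //.
by case: fF => [N [oN Nx FC FE]]; exact: (dir_derive_linear FC Nx).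
Qed.

(** An extension of f at x is also an extension of f at all nearby points of M,
which gives an extension of the derivative along a whole field. *)
Lemma local_ext_tderive W (f : M -> W) (X : M -> U) x F X' :
  (forall y, velocity M (val y) (X y)) -> local_ext f x F -> local_ext X x X' ->
  local_ext (fun y => tderive f y (X y)) x (fun u => dir_derive F u (X' u)).
Proof.
move=> vX [OF [oF OFx FC FE]] [OX [oX OXx XC XE]].
have oFX := vopenI oF oX.
exists (OF `&` OX); split=> // [|y [OFy OXy]].
  apply: smooth_on_dir_derive => //; first by apply: smooth_on_sub FC => u [].
  by apply: smooth_on_sub XC => u [].
by rewrite XE // (@tderiveE _ f y F) //; exists OF.
Qed.

Lemma smooth_tderive W (f : M -> W) (X : M -> U) :
  smooth f -> smooth X -> (forall y, velocity M (val y) (X y)) ->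
  smooth (fun y => tderive f y (X y)).
Proof.
move=> fC XC vX x; have [F fF] := fC x; have [X' XX] := XC x.
by exists (fun u => dir_derive F u (X' u)); exact: local_ext_tderive.
Qed.

(** Commutator of two derivations: on local extensions the second derivatives
of f cancel by symmetry and only the derivatives of the fields remain. *)
Theorem tderive_commutator W (f : M -> W) (X Y : M -> U) x :
  smooth f -> smooth X -> smooth Y ->
  (forall y, velocity M (val y) (X y)) -> (forall y, velocity M (val y) (Y y)) ->
  velocity M (val x) (tderive Y x (X x) - tderive X x (Y x)) ->
  tderive f x (tderive Y x (X x) - tderive X x (Y x)) =
  tderive (fun y => tderive f y (Y y)) x (X x) -
  tderive (fun y => tderive f y (X y)) x (Y x).
Proof.
move=> fC XC YC vX vY.
have [F fF] := fC x; have [X' XX] := XC x; have [Y' YY] := YC x.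
have EXY := tderiveE (local_ext_tderive vY fF YY) (vX x).
have EYX := tderiveE (local_ext_tderive vX fF XX) (vY x).
have := tderiveE XX (vY x); have := tderiveE YY (vX x).
set tY := tderive Y x (X x); set tX := tderive X x (Y x) => /esym EY /esym EX vZ.
apply: (etrans (tderiveE fF vZ)); apply/esym.
apply: (etrans (congr2 (fun a b => a - b) EXY EYX)).
case: fF XX YY => [OF [oF OFx FC FE]] [OX [oX OXx XC' XE]] [OY [oY OYx YC' YE]].
pose N := OF `&` OX `&` OY.
have oN : vopen N by do 2?apply: vopenI.
have Nx : N (val x) by do 2?split.
have FN : smooth_on N F by apply: smooth_on_sub FC => u [[]].
have XN : smooth_on N X' by apply: smooth_on_sub XC' => u [[]].
have YN : smooth_on N Y' by apply: smooth_on_sub YC' => u [].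
have DXY := dir_derive_field (X x) oN Nx FN YN.
have DYX := dir_derive_field (Y x) oN Nx FN XN.
have DC := dir_derive_comm (X x) (Y x) oN Nx FN.
rewrite EY (YE _ OYx) in DXY; rewrite EX (XE _ OXx) in DYX.
apply: (etrans (congr2 (fun a b => a - b) DXY DYX)).
have cancel_sym (a b p q : W) : a = b -> (a + p) - (b + q) = p - q.
  by move=> ->; rewrite opprD addrACA subrr add0r.
apply: (etrans (cancel_sym _ _ _ _ (esym DC))).
have := dir_derive_linear FN Nx (-1) tX tY; rewrite !scaleN1r => L.
by rewrite [tY - tX]addrC; apply: (etrans (addrC _ _)); exact: esym L.
Qed.

End Sections.

(** * Adjoints with respect to the metric *)

Section Adjoint.
Variables (R : realType) (V : vectType R) (g : {dot V for (@idfun R)}).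
Implicit Types (A B : 'End(V)) (x y z : V).

Lemma dot_sym x y : g x y = g y x.
Proof. by rewrite hermC /= mul1r. Qed.

Lemma dotPr a x y z : g x (a *: y + z) = a * g x y + g x z.
Proof. by rewrite linearPr. Qed.

Lemma dotPl a x y z : g (a *: x + y) z = a * g x z + g y z.
Proof. by rewrite dot_sym dotPr dot_sym [g z y]dot_sym. Qed.

Lemma dotDr x y z : g x (y + z) = g x y + g x z.
Proof. by have := dotPr 1 x y z; rewrite scale1r mul1r. Qed.

Lemma dotDl x y z : g (x + y) z = g x z + g y z.
Proof. by have := dotPl 1 x y z; rewrite scale1r mul1r. Qed.

Lemma dotNr x y : g x (- y) = - g x y.
Proof. by rewrite linearNr. Qed.

Lemma dotNl x y : g (- x) y = - g x y.
Proof. by rewrite dot_sym dotNr dot_sym. Qed.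

Lemma dotZr a x y : g x (a *: y) = a * g x y.
Proof. by rewrite linearZr_LR. Qed.

Lemma dotZl a x y : g (a *: x) y = a * g x y.
Proof. by rewrite dot_sym dotZr dot_sym. Qed.

Lemma dot0r x : g x 0 = 0.
Proof. by rewrite linear0r. Qed.

Lemma dot_gt0 x : x != 0 -> 0 < g x x.
Proof. exact: neq0_dnorm_gt0. Qed.

Lemma dot_eq0 x : g x x = 0 -> x = 0.
Proof. by have [//|/dot_gt0/lt0r_neq0/eqP] := eqVneq x 0. Qed.

Lemma dot_inj y z : (forall x, g x y = g x z) -> y = z.
Proof.
move=> yz; apply/subr0_eq/dot_eq0.
by rewrite dotDr dotNr yz subrr.
Qed.

Definition riesz (y : V) : 'Hom(V, R^o) := linfun (g y : V -> R^o).

Fact riesz_linear : linear riesz.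
Proof.
move=> a y z; apply/lfunP => x.
by rewrite add_lfunE scale_lfunE !lfunE /= dotPl.
Qed.
HB.instance Definition _ := GRing.isLinear.Build R V 'Hom(V, R^o) _ riesz riesz_linear.

Lemma rieszE y x : riesz y x = g y x.
Proof. by rewrite lfunE. Qed.

(** The map y |-> g y is injective by positivity, hence onto since V and its
dual have the same dimension. *)
Lemma riesz_surj (l : 'Hom(V, R^o)) : exists y, forall x, l x = g y x.
Proof.
pose L : 'Hom(V, 'Hom(V, R^o)) := linfun riesz.
have kerL : lker L == 0%VS.
  apply/lker0P => y z; rewrite !lfunE /= => yz; apply: dot_inj => x.
  by rewrite dot_sym [RHS]dot_sym -!rieszE yz.
have limL : limg L = fullv.
  apply/eqP; rewrite eqEdim subvf /= (limg_dim_eq (U := fullv)) ?(eqP kerL) ?capv0 //.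
  by rewrite !dimvf /dim /= muln1.
have /memv_imgP[y _ ly] : l \in limg L by rewrite limL memvf.
by exists y => x; rewrite ly lfunE rieszE.
Qed.

(** The adjoint is defined by choice; the Riesz representatives of the forms
x |-> g (A x) y provide a linear map with the required property. *)
Lemma adjointE A x y : g (A x) y = g x (adjoint g A y).
Proof.
suff ex : exists B, [set B : 'End(V) | forall x y, g (A x) y = g x (B y)] B.
  exact: (xgetPex 0 ex).
have adj y' : exists z, forall x, g (A x) y' = g x z.
  have [z zP] := riesz_surj (riesz y' \o A)%VF.
  by exists z => x'; rewrite dot_sym -rieszE -comp_lfunE zP dot_sym.
pose B y' := sval (cid (adj y')).
have BE x' y' : g (A x') y' = g x' (B y') by rewrite /B; case: cid.
have B_linear : linear B.
  move=> a y' z'; apply: dot_inj => x'.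
  by rewrite -BE !dotPr -!BE.
pose BL : {linear V -> V} := HB.pack B (GRing.isLinear.Build _ _ _ _ _ B_linear).
exists (linfun BL) => x' y'; have -> : linfun BL y' = B y' by exact: (lfunE BL).
exact: BE.
Qed.

Lemma adjoint_unique A B : (forall x y, g (A x) y = g x (B y)) -> adjoint g A = B.
Proof. by move=> AB; apply/lfunP => y; apply: dot_inj => x; rewrite -adjointE AB. Qed.

Fact adjoint_linear : linear (adjoint g).
Proof.
move=> a A B; apply: adjoint_unique => x y.
by rewrite !add_lfunE !scale_lfunE dotPl dotPr !adjointE.
Qed.
HB.instance Definition _ :=
  GRing.isLinear.Build R 'End(V) 'End(V) _ (adjoint g) adjoint_linear.

Lemma adjointK A : adjoint g (adjoint g A) = A.
Proof. by apply: adjoint_unique => x y; rewrite dot_sym -adjointE dot_sym. Qed.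

Lemma adjointM A B : adjoint g (A \o B)%VF = (adjoint g B \o adjoint g A)%VF.
Proof. by apply: adjoint_unique => x y; rewrite !comp_lfunE !adjointE. Qed.

Lemma orthogonal_lieP A : orthogonal_lie g A <-> adjoint g A = - A.
Proof.
split=> [skA|AE x y].
  by apply: adjoint_unique => x y; rewrite skA opp_lfunE dotNr.
by rewrite adjointE AE opp_lfunE dotNr.
Qed.

(** For an operator of square -1, being orthogonal and being skew-adjoint are
the same condition. *)
Lemma twistorP (K : 'End(V)) :
  twistor g K <-> (K \o K)%VF = - \1%VF /\ adjoint g K = - K.
Proof.
split=> [[KK gK]|[KK aK]]; split=> //.
  apply/orthogonal_lieP => x y.
  by rewrite -gK -comp_lfunE KK opp_lfunE id_lfunE dotNl.
move=> x y; rewrite adjointE aK opp_lfunE -comp_lfunE KK opp_lfunE id_lfunE.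
by rewrite opprK.
Qed.

End Adjoint.

Section EndomorphismRing.
Variables (R : realType) (V : vectType R).

(** A copy of End V that carries the composition product as ring structure, so
that identities proved in an arbitrary ring apply to endomorphisms. The ring may
be trivial, since V may be the zero space. *)
Definition endo : Type := 'End(V).
HB.instance Definition _ := GRing.Lmodule.on endo.
HB.instance Definition _ := GRing.Zmodule_isPzRing.Build endo
  (@comp_lfunA _ _ _ _ _) (@comp_lfun1l _ _ _) (@comp_lfun1r _ _ _)
  (@comp_lfunDl _ _ _ _) (@comp_lfunDr _ _ _ _).

End EndomorphismRing.

(** * Noncommutative identities for a pair of complex structures *)

Ltac expand :=
  rewrite ?(mulrDl, mulrDr, mulNr, mulrN, mulrBl, mulrBr,
            opprD, opprB, opprK, mulrA, addrA).

(** Proves an equality of sums of signed atoms: the leading atom of the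
difference is cancelled against its opposite, which is first moved next to it.
The trailing 0 lets the last summand be moved like the others. *)
Ltac zmod_cancel :=
  apply: subr0_eq; rewrite -[LHS]addr0; rewrite ?(opprD, opprK); rewrite -?addrA;
  repeat match goal with
  | |- - ?x + ?r = 0 => rewrite ?(addrCA _ x) addNKr
  | |- ?x + ?r = 0 => rewrite ?(addrCA _ (- x)) addKr
  end; try reflexivity.

Section TwistorAlgebra.
Variable A : pzRingType.
Implicit Types a b p q : A.

(** The part of dY(X) - dX(Y) that comes from differentiating S (along X it has
derivative X) and T (derivative - X). Both S b T p S + S a T q S and
T q S a T + T p S b T are symmetric in the exchange of (a, p) with (b, q), so
they disappear; only words of the shape S _ T and T _ S survive. *)
Lemma torsion_formula (S T a b p q : A) :
  let X := - (S * a * T) - T * p * S in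
  let Y := - (S * b * T) - T * q * S in
  (S * b * X - X * b * T + (X * q * S - T * q * X))
  - (S * a * Y - Y * a * T + (Y * p * S - T * p * Y))
  = S * (a * (S + T) * b - b * (S + T) * a) * T +
    T * (q * (S + T) * p - p * (S + T) * q) * S.
Proof.
by move=> /=; expand; zmod_cancel.
Qed.

(** The full Lie bracket dY(X) - dX(Y) is again of the shape of the anchor. The
left-hand side is written as the product rule delivers it, d standing for
derivatives of the coefficients. *)
Lemma bracket_formula (S T a b p q da db dp dq X Y : A) :
  X = - (S * a * T) - T * p * S -> Y = - (S * b * T) - T * q * S ->
  let m := a * (S + T) * b - b * (S + T) * a in
  let m' := q * (S + T) * p - p * (S + T) * q in
  - (S * b * - X + (S * db + X * b) * T) - (T * q * X + (T * dq + - X * q) * S)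
  - (- (S * a * - Y + (S * da + Y * a) * T) - (T * p * Y + (T * dp + - Y * p) * S))
  = - (S * (db - da - m) * T) - T * (dq - dp - m') * S.
Proof.
move=> XE YE m m'; have := torsion_formula S T a b p q.
rewrite /= -XE -YE -/m -/m' => tors {XE YE}; clearbody m m'.
transitivity (S * m * T + T * m' * S - (S * (db - da) * T + T * (dq - dp) * S)).
  by rewrite -tors; expand; zmod_cancel.
by expand; zmod_cancel.
Qed.

Section ComplexStructures.
Context (J K S T : A) (JJ : J * J = -1) (KK : K * K = -1).
Context (defS : S = J + K) (defT : T = J - K).

(** S intertwines the two complex structures, T anti-intertwines them. *)
Lemma mulSK : S * K = J * S.
Proof. by rewrite defS mulrDl mulrDr JJ KK addrC. Qed.
Lemma mulKS : K * S = S * J.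
Proof. by rewrite defS mulrDl mulrDr JJ KK addrC. Qed.
Lemma mulTK : T * K = - (J * T).
Proof. by rewrite defT mulrBl mulrBr JJ KK opprK opprB opprK addrC. Qed.
Lemma mulKT : K * T = - (T * J).
Proof. by rewrite defT mulrBl mulrBr JJ KK opprK opprB opprK addrC. Qed.

(** The commutator with K moves K inwards through S and T, where it becomes J up
to sign, so that only anticommutators with J remain. *)
Lemma anchor_formula a p :
  (S * a * T - T * p * S) * K - K * (S * a * T - T * p * S) =
  - (S * (a * J + J * a) * T) - T * (p * J + J * p) * S.
Proof.
rewrite mulrBl mulrBr -!(mulrA _ _ K) mulTK mulSK !mulrA mulKS mulKT.
by expand; zmod_cancel.
Qed.

Lemma mulSS_TT : S * S + T * T = - (1 + 1 + 1 + 1).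
Proof. by rewrite defS defT; expand; rewrite JJ KK; zmod_cancel. Qed.

Lemma mulSSJ : S * S * J = J * (S * S).
Proof. by rewrite -mulrA -mulKS !mulrA mulSK. Qed.

Lemma mulTTJ : T * T * J = J * (T * T).
Proof. by rewrite -mulrA -[T * J]opprK -mulKT mulrN mulrA mulTK mulNr opprK mulrA. Qed.

Lemma anticomm_J a : (a * J + J * a) * J = J * (a * J + J * a).
Proof. by rewrite mulrDl mulrDr !mulrA JJ -mulrA JJ mulN1r mulrN1 addrC. Qed.

(** Why the algebraic terms of the bracket have the shape they have. Since
S K S = J S^2 and T K T = - J T^2, the sum n is x J S^2 b + a J T^2 y; all of
J, S^2, T^2, a, b commute with J, so anticommuting with J turns x into a and y
into b, giving a J (S^2 + T^2) b = - 4 a J b, and S + T = 2 J. *)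
Lemma bracket_correction x y :
  let a := x * J + J * x in let b := y * J + J * y in
  let n := x * S * K * S * b - a * T * K * T * y in
  n * J + J * n = - (a * (S + T) * b *+ 2).
Proof.
move=> a b n.
have aJ : a * J = J * a := anticomm_J x.
have bJ : b * J = J * b := anticomm_J y.
pose S2 := S * S; pose T2 := T * T.
have nE : n = x * J * S2 * b + a * J * T2 * y.
  rewrite /n /S2 /T2 -(mulrA x S K) mulSK -(mulrA a T K) mulTK.
  by rewrite mulrN !mulNr opprK !mulrA.
have S2J : S2 * J = J * S2 := mulSSJ.
have T2J : T2 * J = J * T2 := mulTTJ.
have -> : n * J + J * n = a * J * (S2 + T2) * b.
  have n1 : x * J * S2 * b * J + J * (x * J * S2 * b) = a * J * S2 * b.
    by rewrite -(mulrA _ b) bJ mulrA -(mulrA _ S2) S2J /a !mulrDl !mulrA.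
  have n2 : a * J * T2 * y * J + J * (a * J * T2 * y) = a * J * T2 * b.
    by rewrite !(mulrA J) -aJ -(mulrA (a * J) J) -T2J /b !mulrDr !mulrA.
  by rewrite nE mulrDl (mulrDr J) addrACA n1 n2 -mulrDl -mulrDr.
have ST : S + T = J + J by rewrite defS defT addrACA subrr addr0.
rewrite mulSS_TT ST mulr2n; expand.
by rewrite !mulr1; zmod_cancel.
Qed.

End ComplexStructures.
End TwistorAlgebra.

(** * Tangent vectors of the twistor space are velocities *)

Section Composition.
Context {R : realType} {V : vectType R}.

Fact comp_lfun_bilinear :
  bilinear_for
    (GRing.Scale.Law.clone _ _ *:%R _) (GRing.Scale.Law.clone _ _ *:%R _)
    (@comp_lfun R V V V).
Proof.
split=> [w|w] a u v /=.
  by rewrite comp_lfunDl -comp_lfunZl.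
by rewrite comp_lfunDr -comp_lfunZr.
Qed.

Definition compb : {bilinear 'End(V) -> 'End(V) -> 'End(V)} :=
  HB.pack (@comp_lfun R V V V)
    (bilinear_isBilinear.Build R _ _ _ _ _ (@comp_lfun R V V V) comp_lfun_bilinear).

Lemma norm_coords_comp : exists2 k : R, 0 < k & forall A B : 'End(V),
  `|coords (A \o B)%VF| <= k * `|coords A| * `|coords B|.
Proof.
have [k k0 kP] := bilinear_schwarz (@coords2_continuous _ _ _ _ compb).
exists k => // A B; have := kP (coords A) (coords B).
by rewrite /= /coords2 !coordsK.
Qed.

End Composition.

(** The Cayley-type curve (1 + t u) K (1 + t u)^-1 for a skew u that
anticommutes with K. It stays in the twistor space because
|(1 + t u) x|^2 = |x|^2 + t^2 |u x|^2, an expression that K preserves. *)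
Section ConjugationCurve.
Context {R : realType} {V : vectType R} (g : {dot V for (@idfun R)}).
Context (K v u : 'End(V)) (hK : twistor g K).
Context (uskew : forall x y, g (u x) y = - g x (u y)).
Context (uK : (u \o K)%VF = - (K \o u)%VF) (Kuu : (K \o u)%VF + (K \o u)%VF = - v).

Let D (t : R) : 'End(V) := \1%VF + t *: u.

Let Dinj t : lker (D t) == 0%VS.
Proof.
apply/lker0P => x y xy; apply/subr0_eq/(dot_eq0 (g := g)).
set z := x - y; have Dz : D t z = 0 by rewrite /z linearB /= xy subrr.
have : g (D t z) z = g z z.
  rewrite /D add_lfunE scale_lfunE id_lfunE dotDl (dot_sym g (t *: _)) dotZr.
  suff -> : g z (u z) = 0 by rewrite mulr0 addr0.
  have := uskew z z; rewrite dot_sym => /eqP.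
  by rewrite -addr_eq0 -mulr2n -mulr_natl mulf_eq0 pnatr_eq0 /= => /eqP.
by rewrite Dz dot_sym dot0r => <-.
Qed.

Let P (t : R) : 'End(V) := ((D t)^-1)%VF.
Let DP t : (D t \o P t)%VF = \1%VF. Proof. exact: lker0_compfV (Dinj t). Qed.

Let c t : 'End(V) := (D t \o K \o P t)%VF.

Let c_twistor t : twistor g (c t).
Proof.
have [KK gK] := hK.
have PD : (P t \o D t)%VF = \1%VF by exact: lker0_compVf (Dinj t).
split=> [|x y].
  rewrite /c -!comp_lfunA (comp_lfunA (P t)) PD comp_lfun1l (comp_lfunA K) KK.
  by rewrite comp_lfunNl comp_lfun1l comp_lfunNr DP.
have dD a b : g (D t a) (D t b) = g a b + t ^+ 2 * g (u a) (u b).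
  rewrite /D !add_lfunE !id_lfunE !scale_lfunE dotDl !dotDr !dotZl !dotZr (uskew a b).
  by rewrite mulrN addrA addrK expr2 mulrA.
have xE z : z = D t (P t z) by rewrite -comp_lfunE DP id_lfunE.
rewrite /c !comp_lfunE !dD gK [in RHS](xE x) [in RHS](xE y) dD; congr (_ + _ * _).
have uKE z : u (K z) = - K (u z) by rewrite -!comp_lfunE uK opp_lfunE comp_lfunE.
by rewrite !uKE dotNl dotNr opprK gK.
Qed.

Let cE t : c t = K + t *: (v \o P t)%VF.
Proof.
have KE : K = (K \o D t \o P t)%VF by rewrite -comp_lfunA DP comp_lfun1r.
rewrite [X in _ = X + _]KE comp_lfunZl -comp_lfunDl /c; congr (_ \o _)%VF.
rewrite /D comp_lfunDl comp_lfunDr comp_lfun1l comp_lfun1r -addrA; congr (_ + _).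
rewrite -comp_lfunZl -comp_lfunZr -scalerDr uK; congr (_ *: _).
by rewrite -[v]opprK -Kuu opprD addrA subrr add0r.
Qed.

Let PE t : P t = \1%VF - t *: (u \o P t)%VF.
Proof.
apply/eqP; rewrite eq_sym subr_eq; apply/eqP.
by rewrite -[LHS](DP t) /D comp_lfunDl comp_lfun1l comp_lfunZl.
Qed.

(** Submultiplicativity of the coordinate norm up to a factor, applied to
P = 1 - t u P, gives |P| <= |1| + |P| / 2 for small t. *)
Let P_bounded : exists2 M : R, 0 < M & \forall t \near (0 : R)^', `|coords (P t)| <= M.
Proof.
have [k k0 kP] := @norm_coords_comp R V.
pose m := `|@coords R _ (\1%VF : 'End(V))|; pose l := k * `|coords u|.
have l0 : 0 <= l by rewrite mulr_ge0 // ltW.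
exists (1 + 2 * m); first by rewrite ltr_pwDl // mulr_ge0 // normr_ge0.
near=> t.
have tl : `|t| * l <= 2^-1.
  have : `|t| <= (2 * (1 + l))^-1 by near: t; apply: dnbhs0_le; rewrite invr_gt0; lra.
  rewrite -[X in _ <= X]mul1r ler_pdivlMr; last by lra.
  by move=> tl; move: (normr_ge0 t) => t0; nra.
have nP : `|coords (P t)| <= m + `|t| * (l * `|coords (P t)|).
  rewrite {1}(PE t) linearB linearZ /= (le_trans (ler_normB _ _)) // lerD2l normrZ.
  by rewrite ler_wpM2l // kP.
have m0 : 0 <= m by exact: normr_ge0.
by move: (normr_ge0 (coords (P t))) (normr_ge0 t) => p0 t0; nra.
Unshelve. all: by end_near. Qed.

Lemma conjugation_velocity : velocity (twistor g) K v.
Proof.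
exists c; split; [exact: c_twistor|by rewrite cE scale0r addr0|].
have [M M0 PM] := P_bounded.
have [k k0 kP] := @norm_coords_comp R V.
pose C := k * `|coords (v \o u)%VF| * M.
have C0 : 0 <= C by rewrite !mulr_ge0 // ltW.
have lim : (fun h : R => h^-1 *: ((coords (U := 'End(V)) \o c) (h *: 1 + 0)
    - (coords (U := 'End(V)) \o c) 0)) @ 0^' --> coords v.
  apply/cvgrPdist_le => e e0; near=> h.
  have h0 : h != 0 by near: h; exact: nbhs_dnbhs_neq.
  rewrite /= addr0 [h *: 1]mulr1 !cE scale0r addr0 -linearB /= addrAC subrr add0r.
  have -> : coords (h *: (v \o P h)%VF) = h *: coords (v \o P h)%VF by exact: linearZ.
  rewrite scalerA mulVf // scale1r -linearB /=.
  (* The difference quotient is v P, which differs from v by h v u P. *)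
  rewrite [P h]PE comp_lfunDr comp_lfun1r comp_lfunNr opprD addrA subrr sub0r opprK.
  rewrite -comp_lfunZr comp_lfunA linearZ normrZ /=.
  apply: (@le_trans _ _ (`|h| * C)).
    rewrite ler_wpM2l // (le_trans (kP _ _)) // ler_wpM2l //.
      by rewrite mulr_ge0 // ltW.
    by near: h.
  have : `|h| <= e / (1 + C) by near: h; apply: dnbhs0_le; rewrite divr_gt0 //; lra.
  rewrite ler_pdivlMr; last by lra.
  by move: (normr_ge0 h) => ? ?; nra.
apply: DeriveDef; first by apply/cvg_ex; exists (coords v).
exact: (cvg_lim _ lim).
Unshelve. all: by end_near. Qed.

End ConjugationCurve.

(** Since v anticommutes with K, so does u = K v / 2, and u is skew as a
product of two anticommuting skew operators. The conjugation curve starts with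
velocity u K - K u = - 2 K u = v. *)
Theorem tangent_velocity (R : realType) (V : vectType R) (g : {dot V for (@idfun R)})
    (K v : 'End(V)) : twistor g K -> tangent g K v -> velocity (twistor g) K v.
Proof.
move=> hK [hv vK]; have [KK aK] := (twistorP g K).1 hK.
have av := (orthogonal_lieP g v).1 hv.
pose u : 'End(V) := 2^-1 *: (K \o v)%VF.
apply: (conjugation_velocity (u := u)) => //.
- suff /orthogonal_lieP uS : adjoint g u = - u by exact: uS.
  rewrite /u linearZ /= adjointM aK av comp_lfunNl comp_lfunNr opprK.
  by rewrite -(addr0_eq vK) scalerN opprK.
- rewrite /u -comp_lfunZl -comp_lfunZr -comp_lfunA -(addr0_eq vK) comp_lfunNr.
  by rewrite scalerN opprK.
- rewrite /u -comp_lfunZr comp_lfunA KK comp_lfunNl comp_lfun1l -scalerDl -div1r.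
  by rewrite -splitr scale1r.
Qed.

(** * Calculus of sections of endomorphisms *)

Section SectionRules.
Context {R : realType} {U : vectType R} {M : set U}.

Lemma smoothN (W : vectType R) (f : M -> W) : smooth f -> smooth (fun x => - f x).
Proof. exact: (smooth_lin (-%R)). Qed.

Lemma tderiveN (W : vectType R) (f : M -> W) x v : smooth f ->
  velocity M (val x) v -> tderive (fun y => - f y) x v = - tderive f x v.
Proof. exact: (tderive_lin (-%R)). Qed.

Lemma smoothZ (W : vectType R) (a : R) (f : M -> W) :
  smooth f -> smooth (fun x => a *: f x).
Proof. exact: (smooth_lin ( *:%R a)). Qed.

Lemma tderiveZ (W : vectType R) (a : R) (f : M -> W) x v : smooth f ->
  velocity M (val x) v -> tderive (fun y => a *: f y) x v = a *: tderive f x v.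
Proof. exact: (tderive_lin ( *:%R a)). Qed.

Variable V : vectType R.
Implicit Types F G : M -> 'End(V).

Lemma smooth_comp F G : smooth F -> smooth G -> smooth (fun x => F x \o G x)%VF.
Proof. exact: (smooth_bilin compb). Qed.

Lemma tderive_comp F G x v : smooth F -> smooth G -> velocity M (val x) v ->
  tderive (fun y => F y \o G y)%VF x v =
  ((F x \o tderive G x v) + (tderive F x v \o G x))%VF.
Proof. exact: (tderive_bilin compb). Qed.

Fact scalar_bilinear (W : vectType R) :
  bilinear_for
    (GRing.Scale.Law.clone _ _ *:%R _) (GRing.Scale.Law.clone _ _ *:%R _)
    (fun (a : R^o) (w : W) => (a : R) *: w).
Proof.
split=> [w|a] c x y /=; first by rewrite scalerDl scalerA.
by rewrite scalerDr !scalerA mulrC.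
Qed.

Definition scalarb (W : vectType R) : {bilinear R^o -> W -> W} :=
  HB.pack (fun (a : R^o) (w : W) => (a : R) *: w)
    (bilinear_isBilinear.Build R R^o W W _ _
       (fun (a : R^o) (w : W) => (a : R) *: w) (scalar_bilinear W)).

Lemma tderive_scale (W : vectType R) (f : M -> R^o) (F : M -> W) x v : smooth f ->
  smooth F -> velocity M (val x) v ->
  tderive (fun y => f y *: F y) x v = f x *: tderive F x v + tderive f x v *: F x.
Proof. exact: (tderive_bilin (scalarb W)). Qed.

End SectionRules.

Lemma comp_lfunPl (R : realType) (V : vectType R) c (X Y Q : 'End(V)) :
  ((c *: X + Y) \o Q)%VF = c *: (X \o Q)%VF + (Y \o Q)%VF.
Proof. by rewrite comp_lfunDl -comp_lfunZl. Qed.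

Lemma comp_lfunPr (R : realType) (V : vectType R) c (X Y P : 'End(V)) :
  (P \o (c *: X + Y))%VF = c *: (P \o X)%VF + (P \o Y)%VF.
Proof. by rewrite comp_lfunDr -comp_lfunZr. Qed.

(** The bracket at a point is built in this pattern out of terms that are linear
in each section. *)
Lemma combine_linear (R : comPzRingType) (W : lmodType R) (c h : R)
    (x x' y y' z z' w w' : W) :
  c *: x + x' - (c *: y + y') + (h *: (c *: z + z') - h *: (c *: w + w')) =
  c *: (x - y + (h *: z - h *: w)) + (x' - y' + (h *: z' - h *: w')).
Proof.
have subP (a a' b b' : W) : c *: a + a' - (c *: b + b') = c *: (a - b) + (a' - b').
  by rewrite opprD addrACA -scalerBr.
have scaleP (a a' : W) : h *: (c *: a + a') = c *: (h *: a) + h *: a'.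
  by rewrite scalerDr !scalerA mulrC.
by rewrite !scaleP !subP addrACA -scalerDr.
Qed.

(** * The skew algebroid *)

Section Anchor.
Variables (R : realType) (V : vectType R) (g : {dot V for (@idfun R)}).
Variables (J : 'End(V)) (hJ : twistor g J).
Local Notation Z := (twistor g).
Implicit Types (A B : Z -> 'End(V)) (K : Z).

Let S : Z -> 'End(V) := Splus J.
Let T : Z -> 'End(V) := Tminus J.
Let ac (A : 'End(V)) : 'End(V) := anticomm A J.

Fact ac_linear : linear ac.
Proof.
move=> a A B; rewrite /ac /anticomm comp_lfunDl comp_lfunDr.
by rewrite -comp_lfunZl -comp_lfunZr addrACA -scalerDr.
Qed.
HB.instance Definition _ := GRing.isLinear.Build R 'End(V) 'End(V) _ ac ac_linear.

Let acP c (A B : 'End(V)) : ac (c *: A + B) = c *: ac A + ac B.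
Proof. exact: ac_linear. Qed.
Let acD (A B : 'End(V)) : ac (A + B) = ac A + ac B. Proof. exact: (linearD ac). Qed.
Let acB (A B : 'End(V)) : ac (A - B) = ac A - ac B. Proof. exact: (linearB ac). Qed.

Let adjB (A B : 'End(V)) : adjoint g (A - B) = adjoint g A - adjoint g B.
Proof. exact: (linearB (adjoint g)). Qed.

Let JJ : (J \o J)%VF = - \1%VF. Proof. by have [] := hJ. Qed.
Let KK K : (val K \o val K)%VF = - \1%VF.
Proof. by have [] := set_valP K. Qed.

(** The anchor depends on A only through anticommutators with J; all later
computations start from this form. *)
Lemma sigmaE K (A : 'End(V)) :
  sigma J K A = - (S K \o ac A \o T K)%VF - (T K \o ac (adjoint g A) \o S K)%VF.
Proof.
exact: (@anchor_formula (endo V) J (val K) (S K) (T K) JJ (KK K) erefl erefl A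
  (adjoint g A)).
Qed.

Lemma sigma_linear K : linear (sigma J K : 'End(V) -> 'End(V)).
Proof.
move=> a A B; rewrite !sigmaE (linearP (adjoint g)) !acP !(comp_lfunPr, comp_lfunPl).
by rewrite !opprD addrACA -!scalerN -scalerDr.
Qed.

Lemma adjoint_phi K : adjoint g (val K) = - val K.
Proof. by have [] := (twistorP g (val K)).1 (set_valP K). Qed.

Lemma adjointJ : adjoint g J = - J.
Proof. by have [] := (twistorP g J).1 hJ. Qed.

Lemma adjointS K : adjoint g (S K) = - S K.
Proof. by rewrite linearD /= adjointJ adjoint_phi opprD. Qed.

Lemma adjointT K : adjoint g (T K) = - T K.
Proof. by rewrite linearB /= adjointJ adjoint_phi opprB opprK addrC. Qed.

Lemma adjoint_ac (A : 'End(V)) : adjoint g (ac A) = - ac (adjoint g A).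
Proof.
rewrite /ac /anticomm linearD /= !adjointM adjointJ.
by rewrite comp_lfunNl comp_lfunNr -opprD addrC.
Qed.

Lemma sigma_tangent K (A : 'End(V)) : tangent g (val K) (sigma J K A).
Proof.
split.
  apply/orthogonal_lieP; rewrite sigmaE linearB linearN /= !adjointM.
  rewrite adjointS adjointT !adjoint_ac adjointK.
  rewrite !(comp_lfunNl, comp_lfunNr) !opprK opprD !opprK addrC.
  by rewrite !comp_lfunA.
(* Every commutator with K anticommutes with K, as K has square -1. *)
set C := ((S K \o A \o T K) - (T K \o adjoint g A \o S K))%VF.
rewrite /sigma -/S -/T -/C /comm /phi comp_lfunDl comp_lfunDr comp_lfunNl comp_lfunNr.
set k := val K; have kk : (k \o k)%VF = - \1%VF := KK K.
rewrite -(comp_lfunA C) (comp_lfunA k C) (comp_lfunA k k) kk comp_lfunNr comp_lfunNl.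
by rewrite comp_lfun1l comp_lfun1r opprK addrA addrNK addNr.
Qed.

Lemma sigma_velocity K (A : 'End(V)) : velocity Z (val K) (sigma J K A).
Proof. exact/tangent_velocity/sigma_tangent/set_valP. Qed.

Let smooth_S : smooth S.
Proof. exact: smoothD (smooth_cst J) (@smooth_val _ _ Z). Qed.

Let smooth_T : smooth T.
Proof. exact: smoothD (smooth_cst J) (smoothN (@smooth_val _ _ Z)). Qed.

Let tderive_S K v : velocity Z (val K) v -> tderive S K v = v.
Proof.
move=> vv; have := tderiveD (smooth_cst J) (@smooth_val _ _ Z) vv.
by rewrite tderive_cst // tderive_val // add0r.
Qed.

Let tderive_T K v : velocity Z (val K) v -> tderive T K v = - v.
Proof.
move=> vv; have := tderiveD (smooth_cst J) (smoothN (@smooth_val _ _ Z)) vv.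
by rewrite tderive_cst // tderiveN ?tderive_val // ?add0r //; exact: smooth_val.
Qed.

Let smooth_ac A : smooth A -> smooth (fun K => ac (A K)).
Proof. exact: smooth_lin. Qed.

Let smooth_adjoint A : smooth A -> smooth (fun K => adjoint g (A K)).
Proof. exact: smooth_lin. Qed.

Lemma smooth_sigma A : smooth A -> smooth (fun K => sigma J K (A K)).
Proof.
move=> sA; rewrite (funext (fun K => sigmaE K (A K))).
apply: smoothD; apply: smoothN; do 2?apply: smooth_comp => //.
  exact: smooth_ac.
by apply/smooth_ac/smooth_adjoint.
Qed.

Lemma tderive_sigma A K v : smooth A -> velocity Z (val K) v ->
  tderive (fun L => sigma J L (A L)) K v =
  - ((S K \o ac (A K) \o - v) +
     ((S K \o ac (tderive A K v)) + (v \o ac (A K)) \o T K))%VF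
  - ((T K \o ac (adjoint g (A K)) \o v) +
     ((T K \o ac (adjoint g (tderive A K v))) + (- v \o ac (adjoint g (A K))) \o S K))%VF.
Proof.
move=> sA vv.
have sa : smooth (fun L => ac (A L)) by exact: smooth_ac.
have sp : smooth (fun L => ac (adjoint g (A L))) by apply/smooth_ac/smooth_adjoint.
have sSa : smooth (fun L => S L \o ac (A L))%VF by exact: smooth_comp.
have sTp : smooth (fun L => T L \o ac (adjoint g (A L)))%VF by exact: smooth_comp.
have sSaT : smooth (fun L => S L \o ac (A L) \o T L)%VF by exact: smooth_comp.
have sTpS : smooth (fun L => T L \o ac (adjoint g (A L)) \o S L)%VF by exact: smooth_comp.
rewrite (funext (fun K => sigmaE K (A K))).
rewrite (tderiveD (smoothN sSaT) (smoothN sTpS) vv) !(tderiveN _ vv) //.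
rewrite (tderive_comp sSa smooth_T vv) (tderive_comp sTp smooth_S vv).
rewrite (tderive_comp smooth_S sa vv) (tderive_comp smooth_T sp vv).
rewrite (tderive_S vv) (tderive_T vv) (tderive_lin ac sA vv).
by rewrite (tderive_lin ac (smooth_adjoint sA) vv) (tderive_lin (adjoint g) sA vv).
Qed.

(** Twice the algebraic part of half of the bracket. *)
Let corr K (A B : 'End(V)) : 'End(V) :=
  ((A \o S K \o val K \o S K \o ac B) - (ac A \o T K \o val K \o T K \o B))%VF.

Let sigma_halfE A B K : sigma_half J A B K =
  tderive B K (sigma J K (A K)) + 2^-1 *: corr K (A K) (B K).
Proof. by rewrite scalerBr addrA. Qed.

(** The term a (S + T) b of the torsion. *)
Let sym K (A B : 'End(V)) : 'End(V) := (ac A \o (S K + T K) \o ac B)%VF.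

Let ac_corr K (A B : 'End(V)) : ac (2^-1 *: corr K A B) = - sym K A B.
Proof.
have E : ac (corr K A B) = - (sym K A B *+ 2).
  exact: (@bracket_correction (endo V) J (val K) (S K) (T K) JJ (KK K) erefl erefl A B).
rewrite linearZ /= E scalerN -(scaler_nat 2 (sym K A B)) scalerA.
by rewrite mulVf ?pnatr_eq0 // scale1r.
Qed.

Let adjoint_sym K (A B : 'End(V)) : adjoint g (sym K A B) =
  - (ac (adjoint g B) \o (S K + T K) \o ac (adjoint g A))%VF.
Proof.
rewrite !adjointM !adjoint_ac (linearD (adjoint g)) /= adjointS adjointT -opprD.
by rewrite !(comp_lfunNl, comp_lfunNr) opprK comp_lfunA.
Qed.

Let bracketE A B K : sigma_bracket J A B K =
  tderive B K (sigma J K (A K)) - tderive A K (sigma J K (B K)) +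
  (2^-1 *: corr K (A K) (B K) - 2^-1 *: corr K (B K) (A K)).
Proof. by rewrite /sigma_bracket !sigma_halfE opprD addrACA. Qed.

(** The anticommutator of the adjoint follows from that of the operator, because
J is skew. *)
Let ac_adjoint (x a b m m' : 'End(V)) : ac x = ac b - ac a - m ->
  adjoint g m = - m' ->
  ac (adjoint g x) = ac (adjoint g b) - ac (adjoint g a) - m'.
Proof.
move=> xE mE; rewrite -[LHS]opprK -(adjoint_ac x) xE !adjB mE !adjoint_ac.
by rewrite !opprD !opprK.
Qed.

(** The anchor carries the bracket to the Lie bracket of vector fields: the
derivatives of A and B in the bracket account for the derivatives of the
coefficients, and the algebraic terms for the derivatives of S and T. *)
Lemma sigma_bracketE A B K : smooth A -> smooth B ->
  sigma J K (sigma_bracket J A B K) =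
  tderive (fun L => sigma J L (B L)) K (sigma J K (A K)) -
  tderive (fun L => sigma J L (A L)) K (sigma J K (B K)).
Proof.
move=> sA sB.
have vA := sigma_velocity K (A K); have vB := sigma_velocity K (B K).
rewrite (tderive_sigma sB vA) (tderive_sigma sA vB).
pose dA := tderive A K (sigma J K (B K)).
pose dB := tderive B K (sigma J K (A K)).
pose p := ac (adjoint g (A K)); pose q := ac (adjoint g (B K)).
pose m : 'End(V) := sym K (A K) (B K) - sym K (B K) (A K).
pose m' : 'End(V) := ((q \o (S K + T K) \o p) - (p \o (S K + T K) \o q))%VF.
have acE : ac (sigma_bracket J A B K) = ac dB - ac dA - m.
  rewrite bracketE acD !acB !ac_corr; congr (_ + _).
  by rewrite /m opprB opprK addrC.
have acE' : ac (adjoint g (sigma_bracket J A B K)) =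
    ac (adjoint g dB) - ac (adjoint g dA) - m'.
  have adj_m : adjoint g m = - m'.
    by rewrite adjB !adjoint_sym opprK /m' opprB addrC.
  exact: ac_adjoint acE adj_m.
rewrite sigmaE acE acE'; apply/esym.
exact: (@bracket_formula (endo V) (S K) (T K) (ac (A K)) (ac (B K)) p q
  (ac dA) (ac dB) (ac (adjoint g dA)) (ac (adjoint g dB)) _ _
  (sigmaE K (A K)) (sigmaE K (B K))).
Qed.

Let smooth_corr A B : smooth A -> smooth B ->
  smooth (fun K => corr K (A K) (B K)).
Proof.
move=> sA sB.
have sa : smooth (fun K => ac (A K)) by exact: smooth_ac.
have sb : smooth (fun K => ac (B K)) by exact: smooth_ac.
have sv : smooth (val : Z -> 'End(V)) by exact: smooth_val.
by apply: smoothD; [|apply: smoothN]; do 4?apply: smooth_comp => //.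
Qed.

Lemma smooth_sigma_half A B : smooth A -> smooth B -> smooth (sigma_half J A B).
Proof.
move=> sA sB; rewrite (funext (sigma_halfE A B)); apply: smoothD.
  apply: smooth_tderive => //; first exact: smooth_sigma.
  by move=> K; exact: sigma_velocity.
by apply: smoothZ; exact: smooth_corr.
Qed.

Lemma smooth_sigma_bracket A B : smooth A -> smooth B ->
  smooth (sigma_bracket J A B).
Proof.
by move=> sA sB; apply: smoothD; [|apply: smoothN]; apply: smooth_sigma_half.
Qed.

Lemma sigma_field A : smooth A -> vector_field (fun K => sigma J K (A K)).
Proof. by move=> sA; split=> [|K]; [exact: smooth_sigma|exact: sigma_tangent]. Qed.

Lemma sigma_is_lie_bracket A B : smooth A -> smooth B ->
  is_lie_bracket (fun K => sigma J K (A K)) (fun K => sigma J K (B K))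
    (fun K => sigma J K (sigma_bracket J A B K)).
Proof.
move=> sA sB; split; first exact/sigma_field/smooth_sigma_bracket.
move=> f sf K; rewrite /lie_derive.
have E := sigma_bracketE K sA sB.
have vX L := sigma_velocity L (A L); have vY L := sigma_velocity L (B L).
(* The Lie bracket of the fields is tangent because it is a value of sigma. *)
have vZ := sigma_velocity K (sigma_bracket J A B K).
rewrite E in vZ *.
exact: tderive_commutator sf (smooth_sigma sA) (smooth_sigma sB) vX vY vZ.
Qed.

Let corr_linearl K c (A A' B : 'End(V)) :
  corr K (c *: A + A') B = c *: corr K A B + corr K A' B.
Proof.
by rewrite /corr acP !comp_lfunPl scalerBr opprD addrACA.
Qed.

Let corr_linearr K c (A B B' : 'End(V)) :
  corr K A (c *: B + B') = c *: corr K A B + corr K A B'.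
Proof.
by rewrite /corr acP !comp_lfunPr scalerBr opprD addrACA.
Qed.

Let tderive_sigma_linear A K : smooth A ->
  linear (fun X : 'End(V) => tderive A K (sigma J K X)).
Proof.
move=> sA c X Y; rewrite sigma_linear; apply: tderive_linear => //;
  rewrite -?sigma_linear; exact: sigma_velocity.
Qed.

Lemma sigma_bracket_linear c A A' B K : smooth A -> smooth A' -> smooth B ->
  sigma_bracket J (fun L => c *: A L + A' L) B K =
  c *: sigma_bracket J A B K + sigma_bracket J A' B K.
Proof.
move=> sA sA' sB; have vB := sigma_velocity K (B K).
have linA : tderive (fun L => c *: A L + A' L) K (sigma J K (B K)) =
    c *: tderive A K (sigma J K (B K)) + tderive A' K (sigma J K (B K)).
  apply: (etrans (tderiveD (smoothZ c sA) sA' vB)).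
  by congr (_ + _); exact: (tderiveZ c sA vB).
rewrite !bracketE linA (tderive_sigma_linear _ sB).
by rewrite corr_linearl corr_linearr combine_linear.
Qed.

Lemma sigma_bracket_leibniz A B (f : Z -> R^o) K :
  smooth A -> smooth B -> smooth f ->
  sigma_bracket J A (fun L => f L *: B L) K =
  f K *: sigma_bracket J A B K + lie_derive (fun L => sigma J L (A L)) f K *: B K.
Proof.
move=> sA sB sf; have vA := sigma_velocity K (A K).
(* In the shape c X + X' with X' = 0 that combine_linear expects. *)
have scale (F : 'End(V) -> 'End(V)) (c : R) (X : 'End(V)) : linear F ->
    F (c *: X) = c *: F X + 0.
  move=> linF; have F0 : F 0 = 0.
    by have := linF (-1) 0 0; rewrite scaler0 addr0 scaleN1r addNr.
  by rewrite -[c *: X]addr0 linF F0.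
rewrite /lie_derive !bracketE; set df := tderive f K _.
have -> : tderive (fun L => f L *: B L) K (sigma J K (A K)) =
    (f K : R) *: tderive B K (sigma J K (A K)) + (df : R) *: B K.
  exact: tderive_scale sf sB vA.
rewrite (scale _ _ _ (tderive_sigma_linear K sA)).
rewrite (scale (corr K (A K)) _ _ (fun c => corr_linearr K c (A K))).
rewrite (scale (corr K ^~ (A K)) _ _ (fun c X Y => corr_linearl K c X Y (A K))).
by rewrite combine_linear !scaler0 !subr0 addr0.
Qed.

End Anchor.

Theorem theorem3p12 (R : realType) (n : nat) (V : vectType R)
    (dimV : \dim {:V} = (2 * n)%N) (g : {dot V for (@idfun R)})
    (J : 'End(V)) (hJ : twistor g J) :
  skew_algebroid (sigma_bracket (g := g) J) (sigma (g := g) J).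
Proof.
split.
- exact: sigma_linear.
- exact: sigma_field.
- exact: smooth_sigma_bracket.
- by move=> a A B C sA sB sC K; exact: sigma_bracket_linear.
- by move=> A B _ _ K; exact: esym (opprB _ _).
- exact: sigma_is_lie_bracket.
- by move=> A B f sA sB sf K; exact: sigma_bracket_leibniz.
Qed.
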